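(* In scheme (H) of the context choose $\bar\lambda_{k+1}=\lambda_k+\frac{\alpha_k}{\theta_k}(Av_{k+1}+Bw_k-b)$. Then (H) reduces to the following algorithm, started with $(x_0,v_0)\in\mathcal X\times\mathcal X$: $$\begin{cases}u_k=(x_k+\alpha_kv_k)/(1+\alpha_k),\quad d_k=\nabla f_1(u_k)+A^\top\lambda_k,\\ v_{k+1}=\operatorname{argmin}_{v\in\mathcal X}\left\{f_2(v)+\langle d_k,v\rangle+\frac{\alpha_k}{2\theta_k}\|Av+Bw_k-b\|^2+\frac{\widetilde\eta_{f,k}}{2\alpha_k}\|v-\widetilde v_k\|^2\right\},\\ x_{k+1}=(x_k+\alpha_kv_{k+1})/(1+\alpha_k),\\ \bar\lambda_{k+1}=\lambda_k+\frac{\alpha_k}{\theta_k}(Av_{k+1}+Bw_k-b),\\ y_{k+1}=\operatorname{prox}^{\mathcal Y}_{\tau_kg}(\widetilde y_k-\tau_kB^\top\bar\lambda_{k+1}),\quad\tau_k=\alpha_k^2/\eta_{g,k},\\ w_{k+1}=y_{k+1}+(y_{k+1}-y_k)/\alpha_k,\\ \lambda_{k+1}=\lambda_k+\frac{\alpha_k}{\theta_k}(Av_{k+1}+Bw_{k+1}-b).\end{cases}$$ Assume $g\in\mathcal S^0_{\mu_g}(\mathcal Y)$ with $\mu_g\ge0$; $f=f_1+f_2$ with $f_2\in\mathcal S^0_0(\mathcal X)$ and $f_1\in\mathcal S^{1,1}_{\mu_f,L_f}(\mathcal X)$, $0\le\mu_f\le L_f<\infty$; $\gamma_0=\mu_f$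 if $\mu_f>0$ and $\beta_0=\mu_g$ if $\mu_g>0$; and that the step sizes satisfy, for all $k$, $$\left(L_f\beta_k\theta_k+\gamma_k\|B\|^2\right)\alpha_k^2=\gamma_k\beta_k\theta_k .$$ Then $\{(x_k,y_k)\}_{k\ge1}\subset\mathcal X\times\mathcal Y$ and $$\|Ax_k+By_k-b\|\le\theta_k\mathcal R_0,\qquad|F(x_k,y_k)-F^*|\le\theta_k(\mathcal E_0+\|\lambda^*\|\mathcal R_0),$$ where $\mathcal R_0=\sqrt{2\mathcal E_0}+\|\lambda_0-\lambda^*\|+\|Ax_0+By_0-b\|$. Moreover, provided that $\gamma_0\beta_0\le L_f\beta_0+\gamma_0\|B\|^2$, for all $k\ge1$, $$\theta_k\le C\left(\min\left\{\frac{\|B\|}{\sqrt{\beta_0}\,k},\ \frac{\|B\|^2}{\mu_gk^2}\right\}+\min\left\{\frac{L_f}{\gamma_0k^2},\ \exp\left(-\frac k4\sqrt{\frac{\mu_f}{L_f}}\right)\right\}\right)$$ with a constant $C>0$ independent of $k$, $A$, $B$, $\mu_f$, $\mu_g$, $\gamma_0$ and $\beta_0$.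
   Context: Setting. $\mathcal X\subset\mathbb R^m$, $\mathcal Y\subset\mathbb R^n$ are closed convex sets, $A\in\mathbb R^{r\times m}$, $B\in\mathbb R^{r\times n}$, $b\in\mathbb R^r$, and $f:\mathbb R^m\to\mathbb R\cup\{+\infty\}$, $g:\mathbb R^n\to\mathbb R\cup\{+\infty\}$ are proper closed convex. The problem is to minimize $F(x,y)=f(x)+g(y)$ over $x\in\mathcal X,y\in\mathcal Y$ subject to $Ax+By=b$. $\mathcal L(x,y,\lambda)=F(x,y)+\delta_{\mathcal X\times\mathcal Y}(x,y)+\langle\lambda,Ax+By-b\rangle$ ($\delta$: indicator function). $(x^*,y^*,\lambda^* )\in\mathcal X\times\mathcal Y\times\mathbb R^r$ is a saddle point of $\mathcal L$ (assumed to exist): $\mathcal L(x^*,y^*,\lambda)\le\mathcal L(x^*,y^*,\lambda^* )\le\mathcal L(x,y,\lambda^* )$ for all $(x,y,\lambda)$; $F^*=F(x^*,y^* )$. Norms are Euclidean, and $\|A\|,\|B\|$ are the induced operator norms. $h\in\mathcal S^0_\mu(\mathcal X)$ means $h$ is proper closed convex and $h(x_1)-h(x_2)-\langle p,x_1-x_2\rangle\ge\frac\mu2\|x_1-x_2\|^2$ for all $x_1,x_2\in\mathcal X$, $p\in\partial h(x_2)$. $h\in\mathcal S^{1,1}_{\mu,L}(\mathcal X)$ means $h\in\mathcal S^0_\mu(\mathcal X)$ and $h$ has $L$-Lipschitz gradient in the sense $h(x_1)-h(x_2)-\langle\nabla h(x_2),x_1-x_2\rangle\le\frac L2\|x_1-x_2\|^2$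 for all $x_1,x_2\in\mathcal X$. The classes over $\mathcal Y$ are analogous. $\operatorname{prox}^{\mathcal Y}_{\tau g}(z)=\operatorname{argmin}_{y\in\mathcal Y}\{g(y)+\frac1{2\tau}\|y-z\|^2\}$. Parameters. $\theta_0=1$, $\gamma_0>0$, $\beta_0>0$, step sizes $\alpha_k>0$, and $$\frac{\theta_{k+1}-\theta_k}{\alpha_k}=-\theta_{k+1},\quad\frac{\gamma_{k+1}-\gamma_k}{\alpha_k}=\mu_f-\gamma_{k+1},\quad\frac{\beta_{k+1}-\beta_k}{\alpha_k}=\mu_g-\beta_{k+1}.$$ $\widetilde\eta_{f,k}=\gamma_k+\mu_f\alpha_k$, $\widetilde v_k=\frac1{\widetilde\eta_{f,k}}(\gamma_kv_k+\mu_f\alpha_ku_k)$, $\eta_{g,k}=(\alpha_k+1)\beta_k+\mu_g\alpha_k$, $\widetilde y_k=y_k+\frac{\alpha_k\beta_k}{\eta_{g,k}}(w_k-y_k)$. Scheme (H), from an initial guess $(x_0,v_0,y_0,w_0,\lambda_0)$ with $(x_0,v_0)\in\mathcal X\times\mathcal X$; it is implicit, with the value $\bar\lambda_{k+1}$ (to be chosen) treated as a fixed vector inside the argmins: $$\begin{cases}u_k=(x_k+\alpha_kv_k)/(1+\alpha_k),\\ v_{k+1}=\operatorname{argmin}_{v\in\mathcal X}\{f_2(v)+\langle\nabla f_1(u_k)+A^\top\bar\lambda_{k+1},v\rangle+\frac{\widetilde\eta_{f,k}}{2\alpha_k}\|v-\widetilde v_k\|^2\},\\ x_{k+1}=(x_k+\alpha_kv_{k+1})/(1+\alpha_k),\\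 y_{k+1}=\operatorname{argmin}_{y\in\mathcal Y}\{g(y)+\langle By,\bar\lambda_{k+1}\rangle+\frac{\eta_{g,k}}{2\alpha_k^2}\|y-\widetilde y_k\|^2\},\\ w_{k+1}=y_{k+1}+(y_{k+1}-y_k)/\alpha_k,\\ \lambda_{k+1}=\lambda_k+\frac{\alpha_k}{\theta_k}(Av_{k+1}+Bw_{k+1}-b).\end{cases}$$ Discrete Lyapunov function: $\mathcal E_k=\mathcal L(x_k,y_k,\lambda^* )-\mathcal L(x^*,y^*,\lambda_k)+\frac{\gamma_k}2\|v_k-x^*\|^2+\frac{\beta_k}2\|w_k-y^*\|^2+\frac{\theta_k}2\|\lambda_k-\lambda^*\|^2$. Convention: a term with $\mu_g$ in the denominator is $+\infty$ when $\mu_g=0$; the exponential is $1$ when $\mu_f=0$.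
   Formalization: In the class S^0_mu(X) (likewise over Y), p ranges over subgradients of h restricted to X, i.e. of h + δ_X, instead of ∂h; with ∂h possibly empty on the set, the strong convexity condition can be void and the bounds fail. *)

(* Defs.v *)
From mathcomp Require Import all_boot all_order all_algebra.
From mathcomp Require Import all_classical all_reals all_analysis.

Set Implicit Arguments.
Unset Strict Implicit.
Unset Printing Implicit Defensive.

Import Order.TTheory GRing.Theory Num.Theory.
Import numFieldNormedType.Exports.

Local Open Scope classical_set_scope.
Local Open Scope ring_scope.

Section EuclideanSpace.
Context {R : realType}.

Definition dot m (x y : 'cV[R]_m) : R := \sum_i x i ord0 * y i ord0.

(* The library norm `|x| on matrices is the sup norm, hence this one. *)
Definition enorm m (x : 'cV[R]_m) : R := Num.sqrt (dot x x).

Definition opnorm r m (A : 'M[R]_(r, m)) : R :=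
  sup [set enorm (A *m x) | x in [set x : 'cV[R]_m | enorm x <= 1]].

End EuclideanSpace.

Section ConvexFunctions.
Context {R : realType} {m : nat}.
Implicit Types (X : set 'cV[R]_m) (h : 'cV[R]_m -> \bar R).
Local Open Scope ereal_scope.

Definition indic_fun {T : Type} (S : set T) (x : T) : \bar R :=
  if x \in S then 0 else +oo.

Definition proper_fun h :=
  (forall x, h x != -oo) /\ (exists x, h x < +oo).

(* The endpoints t = 0, 1 are harmless, since 0 * +oo = 0 in \bar R. *)
Definition convex_efun h :=
  forall (x y : 'cV[R]_m) (t : R), (0 <= t <= 1)%R ->
    h (t *: x + (1 - t) *: y)%R <= t%:E * h x + (1 - t)%:E * h y.

Definition proper_closed_convex h :=
  [/\ proper_fun h, lower_semicontinuous h & convex_efun h].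

(* p is a subgradient at x of h viewed as a function on X, that is
   p \in \partial (h + \delta_X)(x).  When the sum rule
   \partial (h + \delta_X) = \partial h + N_X holds, as is implicit in the
   optimality conditions of the method, using these subgradients or those of h
   over the whole space gives the same class S0 below.  Without the sum rule
   the latter can be empty at every point of X, which would make the strong
   convexity condition in S0 void. *)
Definition subgradient_on X h (x p : 'cV[R]_m) :=
  h x \is a fin_num /\
  forall z, X z -> h x + (dot p (z - x)%R)%:E <= h z.

Definition S0 (mu : R) X h :=
  proper_closed_convex h /\
  forall x1 x2 p, X x1 -> X x2 -> subgradient_on X h x2 p ->
    (mu / 2 * enorm (x1 - x2) ^+ 2)%:E
      <= h x1 - h x2 - (dot p (x1 - x2)%R)%:E.

Definition differentiable_at h (x : 'cV[R]_m) :=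
  (\forall z \near x, h z \is a fin_num) /\
  differentiable (fun z => fine (h z)) x.

Definition grad h (x : 'cV[R]_m) : 'cV[R]_m :=
  (\col_i 'D_(delta_mx i ord0) (fun z => fine (h z)) x)%R.

Definition S11 (mu L : R) X h :=
  [/\ S0 mu X h,
      forall x, X x -> differentiable_at h x
    & forall x1 x2, X x1 -> X x2 ->
        h x1 - h x2 - (dot (grad h x2) (x1 - x2)%R)%:E
          <= (L / 2 * enorm (x1 - x2) ^+ 2)%:E].

(* As usual for extended-valued functions, argmin_S h is empty when h is
   identically +oo on S. *)
Definition is_argmin X h (x : 'cV[R]_m) :=
  [/\ X x, h x < +oo & forall z, X z -> h x <= h z].

Definition is_prox X (tau : R) h (z x : 'cV[R]_m) :=
  is_argmin X (fun y => h y + (1 / (2 * tau) * enorm (y - z) ^+ 2)%:E) x.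

End ConvexFunctions.

Record parameters_spec {R : realType} (mu_f mu_g : R)
    (alpha theta gamma beta : nat -> R) : Prop := ParametersSpec {
  theta0 : theta 0%N = 1;
  gamma0_gt0 : 0 < gamma 0%N;
  beta0_gt0 : 0 < beta 0%N;
  alpha_gt0 : forall k, 0 < alpha k;
  thetaS : forall k, (theta k.+1 - theta k) / alpha k = - theta k.+1;
  gammaS : forall k, (gamma k.+1 - gamma k) / alpha k = mu_f - gamma k.+1;
  betaS : forall k, (beta k.+1 - beta k) / alpha k = mu_g - beta k.+1
}.

(* The value lbar 0 plays no role. *)
Record iterates (R : realType) (m n r : nat) := Iterates {
  xs : nat -> 'cV[R]_m;
  us : nat -> 'cV[R]_m;
  vs : nat -> 'cV[R]_m;
  ys : nat -> 'cV[R]_n;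
  ws : nat -> 'cV[R]_n;
  lam : nat -> 'cV[R]_r;
  lbar : nat -> 'cV[R]_r
}.

Section Scheme.
Context {R : realType} {m n r : nat}.
Variables (X : set 'cV[R]_m) (Y : set 'cV[R]_n).
Variables (A : 'M[R]_(r, m)) (B : 'M[R]_(r, n)) (b : 'cV[R]_r).
Variables (f1 f2 : 'cV[R]_m -> \bar R) (g : 'cV[R]_n -> \bar R).
Variables (mu_f mu_g : R) (alpha theta gamma beta : nat -> R).
Variable it : iterates R m n r.

Let x := xs it.
Let u := us it.
Let v := vs it.
Let y := ys it.
Let w := ws it.
Let la := lam it.
Let lb := lbar it.

Definition eta_f k : R := gamma k + mu_f * alpha k.

Definition eta_g k : R := (alpha k + 1) * beta k + mu_g * alpha k.

Definition v_tilde k : 'cV[R]_m :=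
  (eta_f k)^-1 *: (gamma k *: v k + (mu_f * alpha k) *: u k).

Definition y_tilde k : 'cV[R]_n :=
  y k + (alpha k * beta k / eta_g k) *: (w k - y k).

Definition tau k : R := alpha k ^+ 2 / eta_g k.

Record scheme_H : Prop := SchemeH {
  H_init : X (x 0%N) /\ X (v 0%N);
  H_u : forall k, u k = (1 + alpha k)^-1 *: (x k + alpha k *: v k);
  H_v : forall k, is_argmin X
    (fun z => f2 z
       + (dot (grad f1 (u k) + A^T *m lb k.+1) z
          + eta_f k / (2 * alpha k) * enorm (z - v_tilde k) ^+ 2)%:E)%E
    (v k.+1);
  H_x : forall k, x k.+1 = (1 + alpha k)^-1 *: (x k + alpha k *: v k.+1);
  H_y : forall k, is_argmin Y
    (fun z => g z
       + (dot (B *m z) (lb k.+1)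
          + eta_g k / (2 * alpha k ^+ 2) * enorm (z - y_tilde k) ^+ 2)%:E)%E
    (y k.+1);
  H_w : forall k, w k.+1 = y k.+1 + (alpha k)^-1 *: (y k.+1 - y k);
  H_lam : forall k,
    la k.+1 = la k + (alpha k / theta k) *: (A *m v k.+1 + B *m w k.+1 - b)
}.

Definition lbar_choice :=
  forall k, lb k.+1 = la k + (alpha k / theta k) *: (A *m v k.+1 + B *m w k - b).

Record algorithm : Prop := Algorithm {
  alg_init : X (x 0%N) /\ X (v 0%N);
  alg_u : forall k, u k = (1 + alpha k)^-1 *: (x k + alpha k *: v k);
  alg_v : forall k, let d := grad f1 (u k) + A^T *m la k in
    is_argmin X
      (fun z => f2 z
         + (dot d z
            + alpha k / (2 * theta k) * enorm (A *m z + B *m w k - b) ^+ 2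
            + eta_f k / (2 * alpha k) * enorm (z - v_tilde k) ^+ 2)%:E)%E
      (v k.+1);
  alg_x : forall k, x k.+1 = (1 + alpha k)^-1 *: (x k + alpha k *: v k.+1);
  alg_lbar : forall k,
    lb k.+1 = la k + (alpha k / theta k) *: (A *m v k.+1 + B *m w k - b);
  alg_y : forall k,
    is_prox Y (tau k) g (y_tilde k - tau k *: (B^T *m lb k.+1)) (y k.+1);
  alg_w : forall k, w k.+1 = y k.+1 + (alpha k)^-1 *: (y k.+1 - y k);
  alg_lam : forall k,
    la k.+1 = la k + (alpha k / theta k) *: (A *m v k.+1 + B *m w k.+1 - b)
}.

End Scheme.

Section Lagrangian.
Context {R : realType} {m n r : nat}.
Variables (X : set 'cV[R]_m) (Y : set 'cV[R]_n).
Variables (A : 'M[R]_(r, m)) (B : 'M[R]_(r, n)) (b : 'cV[R]_r).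
Variables (f : 'cV[R]_m -> \bar R) (g : 'cV[R]_n -> \bar R).
Local Open Scope ereal_scope.

Definition objective x y : \bar R := f x + g y.

Definition lagrangian x y (l : 'cV[R]_r) : \bar R :=
  objective x y + indic_fun (X `*` Y) (x, y)
  + (dot l (A *m x + B *m y - b)%R)%:E.

Definition saddle_point xst yst lst :=
  [/\ X xst, Y yst
    & forall x y l, lagrangian xst yst l <= lagrangian xst yst lst
                 /\ lagrangian xst yst lst <= lagrangian x y lst].

Variables (theta gamma beta : nat -> R) (it : iterates R m n r).
Variables (xst : 'cV[R]_m) (yst : 'cV[R]_n) (lst : 'cV[R]_r).

(* Extended-valued: y_0 need not lie in Y, nor (x_0, y_0) in dom F. *)
Definition lyapunov k : \bar R :=
  lagrangian (xs it k) (ys it k) lst - lagrangian xst yst (lam it k)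
  + (gamma k / 2 * enorm (vs it k - xst) ^+ 2
     + beta k / 2 * enorm (ws it k - yst) ^+ 2
     + theta k / 2 * enorm (lam it k - lst) ^+ 2)%:E.

Definition R0 : \bar R :=
  sqrte (2%:E * lyapunov 0%N)
  + (enorm (lam it 0%N - lst)
     + enorm (A *m xs it 0%N + B *m ys it 0%N - b))%:E.

End Lagrangian.

(* Main.v *)
Require Import Defs.
From mathcomp Require Import all_boot all_order all_algebra.
From mathcomp Require Import all_classical all_reals all_analysis.
From mathcomp Require Import ring lra.
Import Order.TTheory GRing.Theory Num.Theory.
Import numFieldNormedType.Exports.
Local Open Scope classical_set_scope.
Local Open Scope ring_scope.

(* An argmin of a convex function plus a convex quadratic is characterized by
   a variational inequality, and under the choice of lbar both forms of each
   subproblem give the same one; it also says that the negative gradient of the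
   quadratic part is a subgradient.  Inserting these subgradients in the
   (strong) convexity inequalities and using the three point identity, all
   cross terms cancel but |v_{k+1} - v_k|^2 and |w_{k+1} - w_k|^2, whose
   coefficients are nonpositive since the step size rule yields
   Lf alpha^2 <= gamma and |B|^2 alpha^2 <= beta theta.  Thus
   (1 + alpha_k) E_{k+1} <= E_k, that is E_k <= theta_k E_0.  Moreover
   lambda_k - (A x_k + B y_k - b) / theta_k does not depend on k, which turns
   the bound on lambda_k - lambda^* into the feasibility estimate.

   For the rate, put p^2 = Lf / gamma and q^2 = |B|^2 / (beta theta), so that
   the step size rule reads alpha^2 (p^2 + q^2) = 1 and alpha (p + q) >= 1.
   There are potentials P and Q, explicit functions of theta, which increase by
   at least alpha p / 2 and alpha q / 2; hence P_k >= k / 4 or Q_k >= k / 4, and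
   each alternative bounds theta_k by one of the two minima. *)

(** * Euclidean inner product, norm and operator norm *)

Section EuclideanGeometry.
Set Implicit Arguments.
Unset Strict Implicit.
Context {R : realType}.

Section Dot.
Context {m : nat}.
Implicit Types (x y z : 'cV[R]_m) (c : R).

Lemma dotC x y : dot x y = dot y x.
Proof. by apply: eq_bigr => i _; rewrite mulrC. Qed.

Lemma dotDl x y z : dot (x + y) z = dot x z + dot y z.
Proof. by rewrite -big_split; apply: eq_bigr => i _; rewrite mxE mulrDl. Qed.

Lemma dotZl c x y : dot (c *: x) y = c * dot x y.
Proof. by rewrite big_distrr; apply: eq_bigr => i _; rewrite mxE -mulrA. Qed.

Lemma dotNl x y : dot (- x) y = - dot x y.
Proof. by rewrite -scaleN1r dotZl mulN1r. Qed.

Lemma dotDr x y z : dot x (y + z) = dot x y + dot x z.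
Proof. by rewrite dotC dotDl !(dotC x). Qed.

Lemma dotZr c x y : dot x (c *: y) = c * dot x y.
Proof. by rewrite dotC dotZl dotC. Qed.

Lemma dotNr x y : dot x (- y) = - dot x y.
Proof. by rewrite dotC dotNl dotC. Qed.

Lemma dot0r x : dot x 0 = 0.
Proof. by rewrite -(scale0r (0 : 'cV_m)) dotZr mul0r. Qed.

Definition dotE := (dotDl, dotDr, dotNl, dotNr, dotZl, dotZr).

Lemma dot_ge0 x : 0 <= dot x x.
Proof. by apply: sumr_ge0 => i _; rewrite -expr2 sqr_ge0. Qed.

Lemma sqr_enorm x : enorm x ^+ 2 = dot x x.
Proof. by rewrite sqr_sqrtr // dot_ge0. Qed.

Lemma enorm_ge0 x : 0 <= enorm x.
Proof. exact: sqrtr_ge0. Qed.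

Lemma enorm_eq0 x : enorm x = 0 -> x = 0.
Proof.
move=> x0; have: dot x x = 0 by rewrite -sqr_enorm x0 expr0n.
move=> /eqP; rewrite psumr_eq0 => [/allP xx0|i _]; last by rewrite -expr2 sqr_ge0.
apply/colP => i; have := xx0 i (mem_index_enum _).
by rewrite mxE /= mulf_eq0 orbb => /eqP.
Qed.

Lemma enorm0 : enorm (0 : 'cV[R]_m) = 0.
Proof. by rewrite /enorm dot0r sqrtr0. Qed.

Lemma enormZ c x : enorm (c *: x) = `|c| * enorm x.
Proof.
by rewrite /enorm dotZl dotZr mulrA -expr2 sqrtrM ?sqr_ge0 // sqrtr_sqr.
Qed.

(** Expand the square of |y|^2 x - <x, y> y, which is |y|^2 times the difference of the squared
    sides. *)
Lemma Cauchy_Schwarz x y : `|dot x y| <= enorm x * enorm y.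
Proof.
have [/enorm_eq0 ->|y0] := eqVneq (enorm y) 0.
  by rewrite dot0r normr0 enorm0 mulr0.
have y_gt0 : 0 < enorm y ^+ 2.
  by rewrite exprn_gt0 // lt_neqAle eq_sym y0 enorm_ge0.
rewrite -ler_sqr ?nnegrE ?mulr_ge0 ?enorm_ge0 // real_normK ?num_real //.
rewrite exprMn -subr_ge0 -(pmulr_rge0 _ y_gt0).
have := dot_ge0 (enorm y ^+ 2 *: x - dot x y *: y).
rewrite !dotE (dotC y x) -!sqr_enorm; congr (0 <= _); ring.
Qed.

Lemma enormD x y : enorm (x + y) <= enorm x + enorm y.
Proof.
rewrite -ler_sqr ?nnegrE ?addr_ge0 ?enorm_ge0 //.
rewrite sqr_enorm sqrrD !sqr_enorm !dotE (dotC y x).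
have := Cauchy_Schwarz x y; rewrite ler_norml => /andP[_]; lra.
Qed.

Lemma enormN x : enorm (- x) = enorm x.
Proof. by rewrite -scaleN1r enormZ normrN1 mul1r. Qed.

Lemma enormB x y : enorm (x - y) <= enorm x + enorm y.
Proof. by rewrite -(enormN y) enormD. Qed.

End Dot.

Lemma dot_mulmx m r (A : 'M[R]_(r, m)) x y :
  dot (A *m x) y = dot x (A^T *m y).
Proof.
have dot_mx k (u w : 'cV[R]_k) : dot u w = (u^T *m w) ord0 ord0.
  by rewrite mxE; apply: eq_bigr => i _; rewrite !mxE.
by rewrite !dot_mx trmx_mul mulmxA.
Qed.

(** Cauchy-Schwarz on each row gives the Frobenius norm as a bound. It makes the set in [opnorm]
    bounded, so that its [sup] is an upper bound. *)
Lemma enorm_mulmx_bounded m r (A : 'M[R]_(r, m)) :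
  exists2 M : R, 0 <= M & forall x, enorm (A *m x) <= M * enorm x.
Proof.
exists (Num.sqrt (\sum_i enorm (row i A)^T ^+ 2)) => [|x]; first exact: sqrtr_ge0.
rewrite -ler_sqr ?nnegrE ?mulr_ge0 ?sqrtr_ge0 ?enorm_ge0 // exprMn.
rewrite [X in _ <= X * _]sqr_sqrtr ?sumr_ge0 // => [|i _]; last exact: sqr_ge0.
rewrite sqr_enorm {1}/dot mulr_suml; apply: ler_sum => i _.
have -> : (A *m x) i ord0 = dot (row i A)^T x.
  by rewrite mxE; apply: eq_bigr => j _; rewrite !mxE.
rewrite -expr2 -exprMn -real_normK ?num_real //.
by rewrite ler_sqr ?nnegrE ?mulr_ge0 ?enorm_ge0 // Cauchy_Schwarz.
Qed.

Lemma le_opnorm m r (A : 'M[R]_(r, m)) x :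
  enorm x <= 1 -> enorm (A *m x) <= opnorm A.
Proof.
move=> x1; apply: ub_le_sup; last by exists x.
have [M M0 AM] := enorm_mulmx_bounded A.
exists M => _ [z /= z1 <-]; apply: le_trans (AM z) _.
by rewrite ler_piMr.
Qed.

Lemma opnorm_ge0 m r (A : 'M[R]_(r, m)) : 0 <= opnorm A.
Proof.
by apply: le_trans (enorm_ge0 (A *m 0)) _; rewrite le_opnorm // enorm0.
Qed.

Lemma enorm_mulmx_le m r (A : 'M[R]_(r, m)) x :
  enorm (A *m x) <= opnorm A * enorm x.
Proof.
have [/enorm_eq0 ->|x0] := eqVneq (enorm x) 0.
  by rewrite mulmx0 !enorm0 mulr0.
have x_gt0 : 0 < enorm x by rewrite lt_neqAle eq_sym x0 enorm_ge0.
rewrite -ler_pdivrMr // mulrC -[X in X * _]gtr0_norm ?invr_gt0 //.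
rewrite -enormZ scalemxAr le_opnorm // enormZ gtr0_norm ?invr_gt0 //.
by rewrite mulVf.
Qed.

End EuclideanGeometry.

(** * First-order optimality and gradients of convex functions *)

Section ConvexMinimization.
Set Implicit Arguments.
Unset Strict Implicit.
Context {R : realType} {m : nat}.
Implicit Types (X : set 'cV[R]_m) (h : 'cV[R]_m -> \bar R) (x z q : 'cV[R]_m).

Lemma convex_set_comb X x z (t : R) : convex_set X -> X x -> X z ->
  0 <= t <= 1 -> X (t *: x + (1 - t) *: z).
Proof.
move=> cX Xx Xz /andP[t0 t1].
by have := cX x z (Itv01 t0 t1) (mem_set Xx) (mem_set Xz); rewrite inE.
Qed.

(** A move of size t towards z changes the linear part by order t and [Q] only by order t^2, so the
    linear part decides; conversely [Q] >= 0 can only raise the objective. [Q] is kept abstract to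
    cover both |d|^2 and the penalty |A d|^2. *)
Lemma is_argmin_quadP X h (phi Q : 'cV[R]_m -> R) q x :
  convex_set X -> convex_efun h -> (forall z, h z != -oo%E) ->
  (forall z, phi z = phi x + dot q (z - x) + Q (z - x)) ->
  (forall (t : R) d, Q (t *: d) = t ^+ 2 * Q d) -> (forall d, 0 <= Q d) ->
  is_argmin X (fun z => h z + (phi z)%:E)%E x <->
  [/\ X x, (h x < +oo)%E
    & forall z, X z -> (h x <= h z + (dot q (z - x))%:E)%E].
Proof.
move=> cX ch hNy phiE QZ Q_ge0; split=> -[Xx hx_fin hmin]; split=> //.
- by move: hx_fin; case: (h x) (hNy x) => [a| |] // _; rewrite ?ltry.
- move=> z Xz; have := hmin z Xz; have := hNy z; have := hNy x.
  move: hx_fin; case hxE : (h x) => [a| |] // _ _; case hzE : (h z) => [c| |] //; last first.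
    by move=> _ _; rewrite addye // leey.
  move=> _ _; rewrite -EFinD lee_fin leNgt; apply/negP => lt_ca.
  set s := c + dot q (z - x) - a; have s_lt0 : s < 0 by rewrite /s; lra.
  have Qz := Q_ge0 (z - x).
  (* Moving a fraction t towards z changes the objective by at most t (s + t Q), and this t turns
     the bracket into s / 2 + t s < 0. The summand - s in the denominator allows Q = 0 and gives t
     <= 1. *)
  pose t := - s / (2 * (- s + Q (z - x))).
  have den_gt0 : 0 < 2 * (- s + Q (z - x)) by lra.
  have t_gt0 : 0 < t by rewrite divr_gt0 //; lra.
  have t_le1 : t <= 1 by rewrite ler_pdivrMr //; lra.
  have t01 : 0 <= t <= 1 by rewrite ltW.
  have := hmin _ (convex_set_comb cX Xz Xx t01).
  have := ch z x t t01; rewrite hxE hzE.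
  case: (h (t *: z + (1 - t) *: x)) (hNy (t *: z + (1 - t) *: x)) => [e| |] // _.
  rewrite -!EFinM -!EFinD !lee_fin => le_e.
  rewrite [phi (_ + _)]phiE.
  have -> : t *: z + (1 - t) *: x - x = t *: (z - x).
    by apply/colP => i; rewrite !mxE; ring.
  rewrite dotZr QZ => le_a.
  have : 0 <= t * (s + t * Q (z - x)) by rewrite /s; lra.
  rewrite pmulr_rge0 // leNgt => /negP; apply.
  have tE : t * (2 * (- s + Q (z - x))) = - s by rewrite divfK // gt_eqF.
  have -> : t * Q (z - x) = t * s - s / 2 by lra.
  nra.
- by rewrite lte_add_pinfty // ltry.
- move=> z Xz; have := hmin z Xz; have := hNy z; have := hNy x.
  case: (h x) hx_fin => [a| |] // _ _; case: (h z) => [c| |] // _; last by move=> _; rewrite addye // leey.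
  rewrite -!EFinD !lee_fin [phi z]phiE; have := Q_ge0 (z - x); lra.
Qed.

Lemma dot_grad h x d : differentiable_at h x ->
  dot (grad h x) d = 'D_d (fun z => fine (h z)) x.
Proof.
move=> [_ dh]; rewrite /dot deriveE //.
rewrite [d in RHS]matrix_sum_delta linear_sum; apply: eq_bigr => i _.
by rewrite big_ord1 linearZ /= mxE deriveE // mulrC.
Qed.

(** By convexity the difference quotients along the segment from x to z are at most h z - h x for 0
    < t <= 1; their right limit at 0 is the directional derivative. *)
Lemma convex_grad_le h x z : convex_efun h -> (forall z, h z != -oo%E) ->
  differentiable_at h x -> h z \is a fin_num ->
  fine (h x) + dot (grad h x) (z - x) <= fine (h z).
Proof.
move=> ch hNy dh hz; have hx : h x \is a fin_num.
  by have [/nbhs_singleton] := dh.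
rewrite (dot_grad _ dh) -lerBrDl.
have df : derivable (fun z => fine (h z)) x (z - x) by apply: diff_derivable; case: dh.
have cf := cvg_dnbhs_at_right df.
rewrite /derive -(cvg_lim _ cf) //; apply: limr_le; first by apply/cvg_ex; eexists; exact: cf.
near=> t.
have t_gt0 : 0 < t by near: t; exact: nbhs_right_gt.
have t_le1 : t <= 1 by near: t; exact: nbhs_right_le.
have t01 : 0 <= t <= 1 by rewrite ltW.
rewrite /= /shift /=.
have -> : t *: (z - x) + x = t *: z + (1 - t) *: x.
  by apply/colP => i; rewrite !mxE; ring.
have := ch z x t t01; move: (hNy (t *: z + (1 - t) *: x)).
rewrite -(fineK hx) -(fineK hz) -!EFinM -EFinD.
case: (h (t *: z + (1 - t) *: x)) => [e| |] //= _.
rewrite lee_fin => le_e.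
rewrite [X in X <= _](_ : _ = (e - fine (h x)) / t); last by rewrite mulrC.
by rewrite ler_pdivrMr //; lra.
Unshelve. all: by end_near.
Qed.

Lemma subgradient_on_dot X h x p :
  h x \is a fin_num -> (forall z, h z != -oo%E) ->
  (forall z, X z -> (h x <= h z + (dot (- p) (z - x))%:E)%E) ->
  subgradient_on X h x p.
Proof.
move=> hx hNy hp; split=> // z Xz; have := hp z Xz; have := hNy z.
rewrite -(fineK hx); case: (h z) => [c| |] // _; last by move=> _; exact: leey.
by rewrite -!EFinD !lee_fin dotNl; lra.
Qed.

End ConvexMinimization.

(** * One-step inequalities for the primal blocks and the multiplier *)

Section OneStep.
Set Implicit Arguments.
Unset Strict Implicit.
Context {R : realType}.

(** The three point identity: it turns the inner products of the optimality conditions into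
    differences of squared distances. *)
Lemma dot_polar m (a b c : 'cV[R]_m) :
  dot (a - b) (a - c)
  = (enorm (a - b) ^+ 2 + enorm (a - c) ^+ 2 - enorm (b - c) ^+ 2) / 2.
Proof.
rewrite !sqr_enorm !dotE (dotC b a) (dotC c a) (dotC c b); lra.
Qed.

(* Here gr is the gradient of f1 at u, c is A^T lbar, and p is the subgradient
   of f2 at v1 given by optimality, scaled by alpha to avoid a division. *)
Lemma x_step m (L mu alpha gamma : R) (x x1 u v v1 xst gr c p : 'cV[R]_m)
    (f1x f1x1 f1u f1st f2x f2x1 f2v1 f2st : R) :
  0 < alpha -> 0 <= mu -> 0 <= L -> L * alpha ^+ 2 <= gamma ->
  u = (1 + alpha)^-1 *: (x + alpha *: v) ->
  x1 = (1 + alpha)^-1 *: (x + alpha *: v1) ->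
  alpha *: p = - (alpha *: (gr + c) + gamma *: (v1 - v)
                  + (mu * alpha) *: (v1 - u)) ->
  f1x1 <= f1u + dot gr (x1 - u) + L / 2 * enorm (x1 - u) ^+ 2 ->
  f1u + dot gr (x - u) + mu / 2 * enorm (x - u) ^+ 2 <= f1x ->
  f1u + dot gr (xst - u) + mu / 2 * enorm (xst - u) ^+ 2 <= f1st ->
  (1 + alpha) * f2x1 <= f2x + alpha * f2v1 ->
  f2v1 <= f2st + dot p (v1 - xst) ->
  (1 + alpha) * (f1x1 + f2x1 - (f1st + f2st)) - (f1x + f2x - (f1st + f2st))
  + alpha * dot c (v1 - xst)
  + (gamma + mu * alpha) / 2 * enorm (v1 - xst) ^+ 2
  - gamma / 2 * enorm (v - xst) ^+ 2 <= 0.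
Proof.
move=> a_gt0 mu_ge0 L_ge0 La uE x1E pE f1x1_le f1x_ge f1st_ge f2x1_le f2v1_le.
have a1_gt0 : 0 < 1 + alpha by lra.
(* x1 and u are the same average taken at v1 and at v, so the smoothness error is of order alpha^2
   |v1 - v|^2 and gamma can absorb it. *)
have x1u : (1 + alpha) *: (x1 - u) = alpha *: (v1 - v).
  rewrite scalerBr uE x1E !scalerA mulfV ?gt_eqF // !scale1r.
  by apply/colP => i; rewrite !mxE; ring.
(* This second form splits the linear term at x1 into those of the lower bounds at x and at [xst],
   plus a multiple of v1 - xst. *)
have x1u' : (1 + alpha) *: (x1 - u) = (x - u) + alpha *: (v1 - u).
  rewrite scalerBr x1E scalerA mulfV ?gt_eqF // scale1r.
  by apply/colP => i; rewrite !mxE; ring.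
have gr_x1 : (1 + alpha) * dot gr (x1 - u)
    = dot gr (x - u) + alpha * (dot gr (v1 - xst) + dot gr (xst - u)).
  by rewrite -dotZr x1u' dotDr dotZr -dotDr addrA subrK.
have sq_x1 : (1 + alpha) ^+ 2 * enorm (x1 - u) ^+ 2
    = alpha ^+ 2 * enorm (v1 - v) ^+ 2.
  rewrite -!exprMn -[1 + alpha]gtr0_norm // -[alpha in RHS]gtr0_norm //.
  by rewrite -!enormZ x1u.
have sq_x1_le : (1 + alpha) * (L / 2 * enorm (x1 - u) ^+ 2)
    <= gamma / 2 * enorm (v1 - v) ^+ 2.
  apply: le_trans (_ : (1 + alpha) ^+ 2 * (L / 2 * enorm (x1 - u) ^+ 2) <= _).
    apply: ler_wpM2r; first by rewrite mulr_ge0 ?sqr_ge0 //; lra.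
    by rewrite expr2 ler_peMr //; lra.
  rewrite mulrCA sq_x1 mulrA mulrAC.
  have := ler_wpM2r (sqr_ge0 (enorm (v1 - v))) La; lra.
have cross : alpha * dot p (v1 - xst) = - (alpha * dot gr (v1 - xst)
    + alpha * dot c (v1 - xst) + gamma * dot (v1 - v) (v1 - xst)
    + mu * alpha * dot (v1 - u) (v1 - xst)).
  by rewrite -dotZl pE !dotE; ring.
rewrite !dot_polar in cross.
have := ler_wpM2l (ltW a1_gt0) f1x1_le.
have := ler_wpM2l (ltW a_gt0) f1st_ge.
have := ler_wpM2l (ltW a_gt0) f2v1_le.
have := mulr_ge0 mu_ge0 (sqr_ge0 (enorm (x - u))).
have := mulr_ge0 (mulr_ge0 mu_ge0 (ltW a_gt0)) (sqr_ge0 (enorm (v1 - u))).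
have Nu : enorm (xst - u) = enorm (u - xst) by rewrite -opprB enormN.
rewrite Nu in f1st_ge *.
rewrite !(mulrDr (1 + alpha)) gr_x1.
lra.
Qed.

(* Likewise c is B^T lbar, and p is the subgradient of g at y1.  The gain
   beta / 2 * |w1 - w|^2 pays for the error in [multiplier_step]. *)
Lemma y_step n (mu alpha beta : R) (y y1 yst w w1 c p : 'cV[R]_n)
    (gy gy1 gst : R) :
  0 < alpha -> 0 <= mu ->
  w1 = y1 + alpha^-1 *: (y1 - y) ->
  alpha *: p = - (alpha *: c + beta *: (w1 - w) + (mu * alpha) *: (w1 - y1)) ->
  gy1 + dot p (y - y1) + mu / 2 * enorm (y - y1) ^+ 2 <= gy ->
  gy1 + dot p (yst - y1) + mu / 2 * enorm (yst - y1) ^+ 2 <= gst ->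
  (1 + alpha) * (gy1 - gst) - (gy - gst) + alpha * dot c (w1 - yst)
  + (beta + mu * alpha) / 2 * enorm (w1 - yst) ^+ 2
  - beta / 2 * enorm (w - yst) ^+ 2 <= - (beta / 2 * enorm (w1 - w) ^+ 2).
Proof.
move=> a_gt0 mu_ge0 w1E pE gy_ge gst_ge.
(* Hence the subgradient inequalities at y and, with weight alpha, at [yst] merge into a single
   product with w1 - yst. *)
have yE : y - y1 = - (alpha *: (w1 - y1)).
  rewrite w1E [X in alpha *: X]addrAC subrr add0r scalerA mulfV ?gt_eqF // scale1r opprB //.
have pyE : dot p (y - y1) + alpha * dot p (yst - y1)
    = - dot (alpha *: p) (w1 - yst).
  by rewrite yE !dotE; ring.
have cross : - dot (alpha *: p) (w1 - yst) = alpha * dot c (w1 - yst)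
    + beta * dot (w1 - w) (w1 - yst)
    + mu * alpha * dot (w1 - y1) (w1 - yst).
  by rewrite pE !dotE; ring.
rewrite !dot_polar -pyE in cross.
have := ler_wpM2l (ltW a_gt0) gst_ge.
have := mulr_ge0 mu_ge0 (sqr_ge0 (enorm (y - y1))).
have := mulr_ge0 (mulr_ge0 mu_ge0 (ltW a_gt0)) (sqr_ge0 (enorm (w1 - y1))).
have -> : enorm (yst - y1) = enorm (y1 - yst) by rewrite -opprB enormN.
rewrite !mulrDr => h1 h2 h3.
lra.
Qed.

(** [lb] uses w where l1 uses w1, so l1 - lb = (alpha / theta) B (w1 - w). The step size bound lets
    the last term dominate the square of this error, and what remains is the complete square of q -
    e. *)
Lemma multiplier_step m n r (A : 'M[R]_(r, m)) (B : 'M[R]_(r, n))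
    (alpha theta beta : R) (b : 'cV[R]_r) (v1 xst : 'cV[R]_m)
    (w w1 yst : 'cV[R]_n) (l l1 lb lst : 'cV[R]_r) :
  0 < theta -> opnorm B ^+ 2 * alpha ^+ 2 <= beta * theta ->
  A *m xst + B *m yst = b ->
  l1 = l + (alpha / theta) *: (A *m v1 + B *m w1 - b) ->
  lb = l + (alpha / theta) *: (A *m v1 + B *m w - b) ->
  theta / 2 * enorm (l1 - lst) ^+ 2 - theta / 2 * enorm (l - lst) ^+ 2
  + alpha * dot lst (A *m v1 + B *m w1 - b)
  <= alpha * dot (A^T *m lb) (v1 - xst) + alpha * dot (B^T *m lb) (w1 - yst)
     + beta / 2 * enorm (w1 - w) ^+ 2.
Proof.
move=> t_gt0 Ba feas l1E lbE.
pose q := A *m v1 + B *m w1 - b; pose e := B *m (w1 - w).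
pose s := alpha / theta.
have aE : alpha = s * theta by rewrite divfK // gt_eqF.
have lbqe : lb = l + s *: (q - e).
  by rewrite lbE; congr (_ + _ *: _); rewrite /q /e mulmxBr; apply/colP => i;
     rewrite !mxE; ring.
have qE : q = A *m (v1 - xst) + B *m (w1 - yst).
  by rewrite /q -feas !mulmxBr; apply/colP => i; rewrite !mxE; ring.
have -> : alpha * dot (A^T *m lb) (v1 - xst) + alpha * dot (B^T *m lb) (w1 - yst)
    = alpha * dot lb q.
  by rewrite -mulrDr !(dotC (_ *m lb)) -!dot_mulmx -dotDl -qE dotC.
have e_le : s ^+ 2 * theta * enorm e ^+ 2 <= beta * enorm (w1 - w) ^+ 2.
  rewrite -(ler_pM2l t_gt0).
  apply: le_trans (_ : opnorm B ^+ 2 * alpha ^+ 2 * enorm (w1 - w) ^+ 2 <= _).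
    have -> : theta * (s ^+ 2 * theta * enorm e ^+ 2) = alpha ^+ 2 * enorm e ^+ 2.
      by rewrite aE; ring.
    rewrite [leRHS](_ : _ = alpha ^+ 2 * (opnorm B * enorm (w1 - w)) ^+ 2); last by ring.
    apply: ler_wpM2l; first exact: sqr_ge0.
    by rewrite ler_sqr ?nnegrE ?mulr_ge0 ?enorm_ge0 ?opnorm_ge0 // enorm_mulmx_le.
  rewrite [leRHS](_ : _ = beta * theta * enorm (w1 - w) ^+ 2); last by ring.
  by apply: ler_wpM2r; first exact: sqr_ge0.
have qe : 0 <= s ^+ 2 * theta * enorm (q - e) ^+ 2.
  exact: mulr_ge0 (mulr_ge0 (sqr_ge0 s) (ltW t_gt0)) (sqr_ge0 _).
move: e_le qe; rewrite l1E -/q -/s lbqe aE.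
move: (q) (e) (s) => q' e' s'.
rewrite !sqr_enorm !dotE (dotC q' l) (dotC lst l) (dotC lst q') (dotC e' q').
lra.
Qed.

End OneStep.

(** * Parameter recurrences and the decay rate of theta *)

Section Rate.
Set Implicit Arguments.
Unset Strict Implicit.
Context {R : realType}.
Variables (mu_f mu_g : R) (alpha theta gamma beta : nat -> R).
Hypothesis params : parameters_spec mu_f mu_g alpha theta gamma beta.

Let a_gt0 := alpha_gt0 params.

(** The implicit rule solved for the new value; theta, gamma and beta are all instances, with mu = 0
    for theta. *)
Lemma relaxationS (mu : R) (s : nat -> R) k :
  (s k.+1 - s k) / alpha k = mu - s k.+1 ->
  s k.+1 * (1 + alpha k) = s k + mu * alpha k.
Proof.
move=> sS; have : s k.+1 - s k = (mu - s k.+1) * alpha k.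
  by rewrite -sS divfK // gt_eqF.
by lra.
Qed.

Lemma theta_rec k : theta k.+1 * (1 + alpha k) = theta k.
Proof. by rewrite (@relaxationS 0) ?mul0r ?addr0 // (thetaS params) sub0r. Qed.

Lemma gamma_rec k : gamma k.+1 * (1 + alpha k) = gamma k + mu_f * alpha k.
Proof. exact: relaxationS (gammaS params k). Qed.

Lemma beta_rec k : beta k.+1 * (1 + alpha k) = beta k + mu_g * alpha k.
Proof. exact: relaxationS (betaS params k). Qed.

Lemma alpha1_gt0 k : 0 < 1 + alpha k.
Proof. by have := a_gt0 k; lra. Qed.

Lemma relaxation_gt0 (mu : R) (s : nat -> R) :
  (forall k, s k.+1 * (1 + alpha k) = s k + mu * alpha k) ->
  0 <= mu -> 0 < s 0%N -> forall k, 0 < s k.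
Proof.
move=> sS mu0 s0; elim=> [//|k IH].
by rewrite -(pmulr_lgt0 _ (alpha1_gt0 k)) sS ltr_pwDl // mulr_ge0 // ltW.
Qed.

Lemma theta_gt0 k : 0 < theta k.
Proof.
apply: (@relaxation_gt0 0) => //; last by rewrite (theta0 params).
by move=> i; rewrite theta_rec mul0r addr0.
Qed.

Lemma gamma_gt0 k : 0 <= mu_f -> 0 < gamma k.
Proof. by move=> mu0; apply: (relaxation_gt0 gamma_rec) (gamma0_gt0 params) _. Qed.

Lemma beta_gt0 k : 0 <= mu_g -> 0 < beta k.
Proof. by move=> mu0; apply: (relaxation_gt0 beta_rec) (beta0_gt0 params) _. Qed.

Lemma theta_le1 k : theta k <= 1.
Proof.
elim: k => [|k IH]; first by rewrite (theta0 params).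
apply: le_trans IH; rewrite -[leRHS]theta_rec ler_peMr ?ltW ?theta_gt0 //.
by have := a_gt0 k; lra.
Qed.

(** mu is a fixed point of the recurrence; this is how the conditions on gamma_0 and beta_0
    enter. *)
Lemma relaxation_const (mu : R) (s : nat -> R) :
  (forall k, s k.+1 * (1 + alpha k) = s k + mu * alpha k) ->
  s 0%N = mu -> forall k, s k = mu.
Proof.
move=> sS s0; elim=> [//|k IH]; apply: (mulIf (lt0r_neq0 (alpha1_gt0 k))).
by rewrite sS IH; ring.
Qed.

Lemma relaxation_theta (s : nat -> R) :
  (forall k, s k.+1 * (1 + alpha k) = s k + 0 * alpha k) ->
  forall k, s k = s 0%N * theta k.
Proof.
move=> sS; elim=> [|k IH]; first by rewrite (theta0 params) mulr1.
apply: (mulIf (lt0r_neq0 (alpha1_gt0 k))).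
by rewrite sS mul0r addr0 -mulrA theta_rec.
Qed.

(** Passing to k + 1 multiplies 1 / sqrt(theta) by sqrt(1 + alpha), which is at least 1 + alpha /
    4. *)
Lemma sqrt_potential (c : R) k : 0 <= c -> alpha k <= 1 ->
  alpha k / 2 * (c / Num.sqrt (theta k))
  <= 2 * (c / Num.sqrt (theta k.+1)) - 2 * (c / Num.sqrt (theta k)).
Proof.
move=> c0 a1; have a0 := a_gt0 k; have t0 := theta_gt0 k.+1.
rewrite -(theta_rec k) (sqrtrM _ (ltW t0)).
set st := Num.sqrt (theta k.+1); set sa := Num.sqrt (1 + alpha k).
have st_gt0 : 0 < st by rewrite sqrtr_gt0.
have sa_gt0 : 0 < sa by rewrite sqrtr_gt0 alpha1_gt0.
have sa_ge : 1 + alpha k / 4 <= sa.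
  rewrite -ler_sqr ?nnegrE ?(ltW sa_gt0) //; last by lra.
  by rewrite sqr_sqrtr ?(ltW (alpha1_gt0 k)) //; nra.
have -> : c / st = c / (st * sa) * sa by field; rewrite !gt_eqF.
have := mulr_ge0 c0 (ltW (_ : 0 < (st * sa)^-1)).
rewrite invr_gt0 mulr_gt0 // => /(_ isT); nra.
Qed.

(** The difference is ln(1 + alpha) = - ln(1 - alpha / (1 + alpha)) >= alpha / (1 + alpha) >= alpha
    / 2. *)
Lemma ln_potential k : alpha k <= 1 ->
  alpha k / 2 <= ln (theta k) - ln (theta k.+1).
Proof.
move=> a1; have a0 := a_gt0 k; have a10 := alpha1_gt0 k.
rewrite -ln_div ?posrE ?theta_gt0 // -{1}(theta_rec k) mulrAC divff ?gt_eqF ?theta_gt0 //.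
rewrite mul1r -[ln _]opprK -lnV ?posrE //.
have -> : (1 + alpha k)^-1 = 1 + - (alpha k / (1 + alpha k)) by field; rewrite gt_eqF.
have le_a : alpha k / 2 <= alpha k / (1 + alpha k).
  by rewrite ler_pdivlMr // mulrAC ler_pdivrMr //; nra.
have lt_a : alpha k / (1 + alpha k) < 1 by rewrite ltr_pdivrMr //; lra.
have := @le_ln1Dx R (- (alpha k / (1 + alpha k))); lra.
Qed.

(** From exp(y) >= 1 + y^2 / 2 at y = x / 4, whence 32 = 2 * 4^2. *)
Lemma expRN_le (x : R) : 0 < x -> expR (- (x / 4)) <= 32 / x ^+ 2.
Proof.
move=> x0; rewrite expRN -[32 / _]invrK lef_pV2 ?posrE ?invr_gt0 ?expR_gt0 //; last first.
  by rewrite divr_gt0 ?exprn_gt0.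
rewrite invf_div; have := @expR_ge1Dxn R (x / 4) 1.
rewrite /= => /(_ (ltW (divr_gt0 x0 (ltr0n R 4)))).
have -> : 2`!%:R = 2 :> R by [].
lra.
Qed.

(* P is 2 p if mu_f = 0, and - sqrt (L / mu_f) ln theta otherwise. *)
Lemma f_potential (L : R) : 0 <= mu_f <= L -> (0 < mu_f -> gamma 0%N = mu_f) ->
  exists p P : nat -> R,
  [/\ forall k, 0 <= p k /\ p k ^+ 2 * gamma k = L,
      forall k, L / gamma 0%N <= p k ^+ 2,
      0 <= P 0%N,
      forall k, alpha k <= 1 -> alpha k / 2 * p k <= P k.+1 - P k
    & forall k, (0 < k)%N -> k%:R / 4 <= P k ->
      theta k <= 64 * Num.min (L / (gamma 0%N * k%:R ^+ 2))
                              (expR (- (k%:R / 4) * Num.sqrt (mu_f / L)))].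
Proof.
move=> /andP[mu_ge0 muL] g0E; have L0 : 0 <= L by lra.
have g0 := gamma0_gt0 params.
move: mu_ge0; rewrite le_eqVlt => /predU1P[mu0|mu_gt0].
- have gE := relaxation_theta (eq_rect_r (fun z => forall k, _ = _ + z * _) gamma_rec mu0).
  pose c := Num.sqrt (L / gamma 0%N).
  have c2 : c ^+ 2 = L / gamma 0%N by rewrite sqr_sqrtr // divr_ge0 // ltW.
  have p2 k : (c / Num.sqrt (theta k)) ^+ 2 = L / gamma 0%N / theta k.
    by rewrite expr_div_n c2 sqr_sqrtr // ltW // theta_gt0.
  have c0 : 0 <= c by exact: sqrtr_ge0.
  exists (fun k => c / Num.sqrt (theta k)), (fun k => 2 * (c / Num.sqrt (theta k))).
  split=> [k|k||k|k k0 Pk].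
  + split; first by rewrite divr_ge0 ?sqrtr_ge0.
    by rewrite p2 (gE k); field; rewrite !gt_eqF ?theta_gt0.
  + rewrite p2 ler_pdivlMr ?theta_gt0 // ler_piMr ?theta_le1 //.
    by rewrite divr_ge0 // ltW.
  + by rewrite mulr_ge0 // divr_ge0 ?sqrtr_ge0.
  + exact: sqrt_potential.
  (* With [mu_f] = 0 the exponential is 1, and its entry of the minimum follows from theta <= 1. *)
  + rewrite -mu0 mul0r sqrtr0 mulr0 expR0 minr_pMr //.
    rewrite le_min mulr1; apply/andP; split; last by have := theta_le1 k; lra.
    have kR : 0 < k%:R :> R by rewrite ltr0n.
    (* P = 2 p >= k / 4 means p >= k / 8; squaring it produces the constant 64. *)
    have : (k%:R / 8) ^+ 2 <= L / gamma 0%N / theta k.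
      rewrite -p2 ler_sqr ?nnegrE ?divr_ge0 ?sqrtr_ge0 //; lra.
    rewrite ler_pdivlMr ?theta_gt0 // mulrC -ler_pdivlMr ?exprn_gt0 ?divr_gt0 //.
    move=> /le_trans; apply; rewrite le_eqVlt; apply/orP; left; apply/eqP.
    by field; rewrite !gt_eqF.
- have g0mu := g0E mu_gt0; have gE := relaxation_const gamma_rec g0mu.
  have L_gt0 : 0 < L by lra.
  pose c := Num.sqrt (L / mu_f).
  have c_gt0 : 0 < c by rewrite sqrtr_gt0 divr_gt0.
  have c2 : c ^+ 2 = L / mu_f by rewrite sqr_sqrtr // divr_ge0 // ltW.
  exists (fun=> c), (fun k => - c * ln (theta k)); split=> [k|k||k a1|k k0 Pk].
  + by split; [exact: ltW|rewrite c2 gE divfK // gt_eqF].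
  + by rewrite c2 g0mu.
  + by rewrite (theta0 params) ln1 mulr0.
  + have := ler_wpM2r (ltW c_gt0) (ln_potential a1); lra.
  + have kR : 0 < k%:R :> R by rewrite ltr0n.
    have -> : Num.sqrt (mu_f / L) = c^-1 by rewrite -(invf_div L) sqrtrV // ltW // divr_gt0.
    have -> : - (k%:R / 4) * c^-1 = - (k%:R / c / 4) by field; rewrite gt_eqF.
    have th : theta k <= expR (- (k%:R / c / 4)).
      rewrite -[theta k]lnK ?posrE ?theta_gt0 // ler_expR.
      have -> : - (k%:R / c / 4) = - (k%:R / 4) / c by field; rewrite gt_eqF.
      by rewrite ler_pdivlMr //; lra.
    rewrite minr_pMr // le_min; apply/andP; split; last first.
      by have := expR_ge0 (- (k%:R / c / 4)); lra.
    (* The exponential bound must also yield the entry in 1 / k^2: take x = k / c, where c^2 = L /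
       gamma_0. *)
    apply: le_trans th _; apply: le_trans (expRN_le _) _; first by rewrite divr_gt0.
    rewrite expr_div_n c2 g0mu.
    have -> : 32 / (k%:R ^+ 2 / (L / mu_f)) = 32 * (L / (mu_f * k%:R ^+ 2)).
      by field; rewrite !gt_eqF.
    by rewrite ler_wpM2r ?divr_ge0 ?mulr_ge0 ?sqr_ge0 ?(ltW mu_gt0) // ler_nat.
Qed.

(* Q is q if mu_g = 0, and 2 q otherwise. *)
Lemma g_potential (N : R) : 0 <= N -> 0 <= mu_g -> (0 < mu_g -> beta 0%N = mu_g) ->
  exists q Q : nat -> R,
  [/\ forall k, 0 <= q k /\ q k ^+ 2 * (beta k * theta k) = N ^+ 2,
      forall k, N ^+ 2 / beta 0%N <= q k ^+ 2,
      0 <= Q 0%N,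
      forall k, alpha k <= 1 -> alpha k / 2 * q k <= Q k.+1 - Q k
    & forall k, (0 < k)%N -> k%:R / 4 <= Q k ->
      theta k <= 64 * (N / (Num.sqrt (beta 0%N) * k%:R)) /\
      (0 < mu_g -> theta k <= 64 * (N ^+ 2 / (mu_g * k%:R ^+ 2)))].
Proof.
move=> N0 mu_ge0 b0E; have b0 := beta0_gt0 params.
have sb0 : 0 < Num.sqrt (beta 0%N) by rewrite sqrtr_gt0.
pose c := N / Num.sqrt (beta 0%N).
have c0 : 0 <= c by rewrite divr_ge0 // ltW.
have c2 : c ^+ 2 = N ^+ 2 / beta 0%N by rewrite expr_div_n sqr_sqrtr // ltW.
move: mu_ge0; rewrite le_eqVlt => /predU1P[mu0|mu_gt0].
- have bE := relaxation_theta (eq_rect_r (fun z => forall k, _ = _ + z * _) beta_rec mu0).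
  exists (fun k => c / theta k), (fun k => c / theta k).
  have q0 k : 0 <= c / theta k by rewrite divr_ge0 // ltW // theta_gt0.
  split=> // [k|k|k a1|k k0 Qk].
  + split=> //; rewrite (bE k) expr_div_n c2.
    by field; rewrite !gt_eqF ?theta_gt0.
  + rewrite -c2 ler_sqr ?nnegrE // ler_pdivlMr ?theta_gt0 //.
    by rewrite ler_piMr ?theta_le1.
  (* The increment is exactly alpha q, twice what is asked. *)
  + have -> : c / theta k.+1 = c / theta k * (1 + alpha k).
      by rewrite -(theta_rec k); field; rewrite !gt_eqF ?theta_gt0 ?alpha1_gt0.
    have := mulr_ge0 (ltW (a_gt0 k)) (q0 k); lra.
  + split; last by rewrite -mu0 ltxx.
    have kR : 0 < k%:R :> R by rewrite ltr0n.
    move: Qk; rewrite ler_pdivlMr ?theta_gt0 // mulrC -ler_pdivlMr ?divr_gt0 //.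
    move=> /le_trans; apply.
    rewrite [X in 64 * X](_ : _ = c / k%:R); last by rewrite /c; field; rewrite !gt_eqF.
    have -> : c / (k%:R / 4) = 4 * (c / k%:R) by field; rewrite gt_eqF.
    by rewrite ler_wpM2r ?divr_ge0 // ?ler_nat // ltW.
- have b0mu := b0E mu_gt0; have bE := relaxation_const beta_rec b0mu.
  have q0 k : 0 <= c / Num.sqrt (theta k) by rewrite divr_ge0 // sqrtr_ge0.
  have q2 k : (c / Num.sqrt (theta k)) ^+ 2 = N ^+ 2 / mu_g / theta k.
    by rewrite expr_div_n c2 b0mu sqr_sqrtr // ltW // theta_gt0.
  exists (fun k => c / Num.sqrt (theta k)), (fun k => 2 * (c / Num.sqrt (theta k))).
  split=> [k|k||k|k k0 Pk].
  + by split=> //; rewrite q2 bE; field; rewrite !gt_eqF ?theta_gt0.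
  + rewrite q2 b0mu ler_pdivlMr ?theta_gt0 // ler_piMr ?theta_le1 //.
    by rewrite divr_ge0 ?sqr_ge0 // ltW.
  + by rewrite mulr_ge0.
  + exact: sqrt_potential.
  + have kR : 0 < k%:R :> R by rewrite ltr0n.
    have st_gt0 : 0 < Num.sqrt (theta k) by rewrite sqrtr_gt0 theta_gt0.
    split=> [|_].
      (* As theta <= 1, it is enough to bound sqrt(theta), and Q = 2 c / sqrt(theta) >= k / 4 gives
         sqrt(theta) <= 8 c / k. *)
      apply: le_trans (_ : Num.sqrt (theta k) <= _).
        have st1 : Num.sqrt (theta k) <= 1 by rewrite -[leRHS]sqrtr1 ler_sqrt ?theta_le1.
        by rewrite -{1}[theta k]sqr_sqrtr ?(ltW (theta_gt0 k)) // expr2 ler_piMr // ltW.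
      move: Pk; rewrite mulrA ler_pdivlMr // mulrC -ler_pdivlMr ?divr_gt0 //.
      move=> /le_trans; apply.
      rewrite [X in 64 * X](_ : _ = c / k%:R); last by rewrite /c; field; rewrite !gt_eqF.
      have -> : 2 * c / (k%:R / 4) = 8 * (c / k%:R) by field; rewrite gt_eqF.
      by rewrite ler_wpM2r ?divr_ge0 // ?ler_nat // ltW.
    have : (k%:R / 8) ^+ 2 <= N ^+ 2 / mu_g / theta k.
      rewrite -q2 ler_sqr ?nnegrE ?divr_ge0 ?sqrtr_ge0 //; lra.
    rewrite ler_pdivlMr ?theta_gt0 // mulrC -ler_pdivlMr ?exprn_gt0 ?divr_gt0 //.
    move=> /le_trans; apply; rewrite le_eqVlt; apply/orP; left; apply/eqP.
    by field; rewrite !gt_eqF.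
Qed.

(** An alternative implies the bound by the sum, both minima being nonnegative. The entry in 1 /
    [mu_g] is guarded because it stands for +oo when [mu_g] = 0. *)
Lemma theta_rate (L N : R) :
  0 <= mu_f <= L -> (0 < mu_f -> gamma 0%N = mu_f) ->
  0 <= N -> 0 <= mu_g -> (0 < mu_g -> beta 0%N = mu_g) ->
  (forall k, (L * beta k * theta k + gamma k * N ^+ 2) * alpha k ^+ 2
             = gamma k * beta k * theta k) ->
  gamma 0%N * beta 0%N <= L * beta 0%N + gamma 0%N * N ^+ 2 ->
  forall k, (0 < k)%N ->
    theta k <= 64 * Num.min (L / (gamma 0%N * k%:R ^+ 2))
                            (expR (- (k%:R / 4) * Num.sqrt (mu_f / L))) \/
    theta k <= 64 * (N / (Num.sqrt (beta 0%N) * k%:R)) /\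
    (0 < mu_g -> theta k <= 64 * (N ^+ 2 / (mu_g * k%:R ^+ 2))).
Proof.
move=> muL g0E N0 mu_g0 b0E step step0 k k0.
have mu_f0 : 0 <= mu_f by case/andP: muL.
have [p [P [p_gamma p_ge P0 PS P_rate]]] := f_potential muL g0E.
have [q [Q [q_beta q_ge Q0 QS Q_rate]]] := g_potential N0 mu_g0 b0E.
have g0 := gamma0_gt0 params; have b0 := beta0_gt0 params.
have pq1 i : alpha i ^+ 2 * (p i ^+ 2 + q i ^+ 2) = 1.
  have gbt : 0 < gamma i * beta i * theta i.
    by rewrite !mulr_gt0 ?gamma_gt0 ?beta_gt0 ?theta_gt0.
  apply: (mulfI (lt0r_neq0 gbt)); rewrite mulr1 -[RHS]step.
  by rewrite -(p_gamma i).2 -(q_beta i).2; ring.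
(* The condition on gamma_0 beta_0 is this inequality for the initial lower bounds of p^2 and q^2.
   It forces alpha <= 1, which the increments of P and Q require. *)
have pq_ge1 i : 1 <= p i ^+ 2 + q i ^+ 2.
  apply: le_trans (lerD (p_ge i) (q_ge i)).
  have -> : L / gamma 0%N + N ^+ 2 / beta 0%N
      = (L * beta 0%N + gamma 0%N * N ^+ 2) / (gamma 0%N * beta 0%N).
    by field; rewrite !gt_eqF.
  by rewrite ler_pdivlMr ?mulr_gt0 // mul1r.
have alpha_le1 i : alpha i <= 1.
  rewrite -(@ler_pXn2r _ 2) ?nnegrE ?(ltW (a_gt0 i)) // expr1n -[leRHS](pq1 i).
  by rewrite ler_peMr ?sqr_ge0.
have apq i : 1 <= alpha i * (p i + q i).
  have [pi0 _] := p_gamma i; have [qi0 _] := q_beta i; have ai0 := ltW (a_gt0 i).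
  rewrite -(@ler_pXn2r _ 2) ?nnegrE ?mulr_ge0 ?addr_ge0 // expr1n.
  rewrite -(pq1 i) exprMn ler_wpM2l ?sqr_ge0 // sqrrD.
  by have := mulr_ge0 pi0 qi0; lra.
have PQ i : i%:R / 2 <= P i + Q i.
  elim: i => [|i IH]; first by rewrite mul0r addr_ge0.
  have := PS i (alpha_le1 i); have := QS i (alpha_le1 i); have := apq i.
  by rewrite -(natr1 i); lra.
have [/(P_rate k k0)|] := leP (k%:R / 4) (P k); first by left.
by move=> Pk; right; apply: Q_rate => //; have := PQ k; lra.
Qed.

End Rate.

(** * Variational inequalities of the subproblems *)

Section ProximalSteps.
Set Implicit Arguments.
Unset Strict Implicit.
Context {R : realType} {m : nat}.
Variables (X : set 'cV[R]_m) (h : 'cV[R]_m -> \bar R).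
Hypotheses (cX : convex_set X) (ch : convex_efun h)
  (hNy : forall z, h z != -oo%E).

(** Common normal form of the subproblems: [q] is the gradient of the quadratic part at [x], and - q
    is a subgradient of h + \delta_X there. *)
Definition proximal_vi (q x : 'cV[R]_m) :=
  [/\ X x, (h x < +oo)%E
    & forall z, X z -> (h x <= h z + (dot q (z - x))%:E)%E].

Lemma sqr_enorm_expand (x z c : 'cV[R]_m) :
  enorm (z - c) ^+ 2
  = enorm (x - c) ^+ 2 + 2 * dot (x - c) (z - x) + enorm (z - x) ^+ 2.
Proof.
rewrite !sqr_enorm !dotE (dotC z x) (dotC c x) (dotC c z); ring.
Qed.

Lemma argmin_linear_quad (c : 'cV[R]_m) (s : R) (xt x : 'cV[R]_m) : 0 <= s ->
  is_argmin X (fun z => h z + (dot c z + s * enorm (z - xt) ^+ 2)%:E)%E x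
  <-> proximal_vi (c + (2 * s) *: (x - xt)) x.
Proof.
move=> s0; apply: (@is_argmin_quadP _ _ _ _
  (fun z => dot c z + s * enorm (z - xt) ^+ 2) (fun d => s * enorm d ^+ 2)) => //.
- move=> z; rewrite (sqr_enorm_expand x) !(dotDl c) dotZl !(dotDr c) !(dotNr c).
  ring.
- by move=> t d; rewrite enormZ exprMn real_normK ?num_real //; ring.
- by move=> d; rewrite mulr_ge0 ?sqr_ge0.
Qed.

Lemma argmin_penalized_quad r (A : 'M[R]_(r, m)) (e b : 'cV[R]_r)
    (c : 'cV[R]_m) (s1 s2 : R) (xt x : 'cV[R]_m) : 0 <= s1 -> 0 <= s2 ->
  is_argmin X (fun z => h z + (dot c z + s1 * enorm (A *m z + e - b) ^+ 2
                               + s2 * enorm (z - xt) ^+ 2)%:E)%E x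
  <-> proximal_vi (c + (2 * s1) *: (A^T *m (A *m x + e - b))
                   + (2 * s2) *: (x - xt)) x.
Proof.
move=> s10 s20; apply: (@is_argmin_quadP _ _ _ _
  (fun z => dot c z + s1 * enorm (A *m z + e - b) ^+ 2 + s2 * enorm (z - xt) ^+ 2)
  (fun d => s1 * enorm (A *m d) ^+ 2 + s2 * enorm d ^+ 2)) => //.
- move=> z; rewrite (sqr_enorm_expand x z).
  have -> : A *m z + e - b = (A *m x + e - b) + A *m (z - x).
    by rewrite mulmxBr; apply/colP => i; rewrite !mxE; ring.
  have -> : dot c z = dot c x + dot c (z - x) by rewrite -dotDr addrC subrK.
  move: (z - x) (x - xt) (A *m x + e - b) => d w p.
  rewrite !dotDl !dotZl (dotC (A^T *m p)) -dot_mulmx !sqr_enorm !dotDl !dotDr.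
  by rewrite (dotC p (A *m d)); ring.
- by move=> t d; rewrite -scalemxAr !enormZ !exprMn real_normK ?num_real //; ring.
- by move=> d; rewrite addr_ge0 ?mulr_ge0 ?enorm_ge0.
Qed.

(** Shifting the centre by tau c adds the linear term <c, z> up to a constant. *)
Lemma prox_vi (tau : R) (c xt x : 'cV[R]_m) : 0 < tau ->
  is_prox X tau h (xt - tau *: c) x <-> proximal_vi (c + tau^-1 *: (x - xt)) x.
Proof.
move=> t0; apply: (@is_argmin_quadP _ _ _ _
  (fun z => 1 / (2 * tau) * enorm (z - (xt - tau *: c)) ^+ 2)
  (fun d => 1 / (2 * tau) * enorm d ^+ 2)) => //.
- move=> z; rewrite (sqr_enorm_expand x).
  have -> : x - (xt - tau *: c) = (x - xt) + tau *: c.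
    by rewrite opprB addrCA addrC.
  move: (z - x) (x - xt) => d w.
  by rewrite !(dotDl, dotZl); field; rewrite gt_eqF.
- by move=> t d; rewrite enormZ exprMn real_normK ?num_real //; ring.
- by move=> d; rewrite mulr_ge0 ?sqr_ge0 // divr_ge0 // mulr_ge0 // ltW.
Qed.

End ProximalSteps.

(** * Equivalence of scheme (H) and the algorithm *)

Section Equivalence.
Set Implicit Arguments.
Unset Strict Implicit.
Context {R : realType} {m n r : nat}.
Variables (X : set 'cV[R]_m) (Y : set 'cV[R]_n).
Variables (A : 'M[R]_(r, m)) (B : 'M[R]_(r, n)) (b : 'cV[R]_r).
Variables (f1 f2 : 'cV[R]_m -> \bar R) (g : 'cV[R]_n -> \bar R).
Variables (mu_f mu_g : R) (alpha theta gamma beta : nat -> R).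
Variable it : iterates R m n r.
Hypotheses (cX : convex_set X) (cY : convex_set Y).
Hypotheses (f2_convex : convex_efun f2) (f2Ny : forall z, f2 z != -oo%E).
Hypotheses (g_convex : convex_efun g) (gNy : forall z, g z != -oo%E).
Hypotheses (mu_f_ge0 : 0 <= mu_f) (mu_g_ge0 : 0 <= mu_g).
Hypothesis params : parameters_spec mu_f mu_g alpha theta gamma beta.

Lemma eta_f_gt0 k : 0 < eta_f mu_f alpha gamma k.
Proof.
by rewrite ltr_pwDl ?(gamma_gt0 params) // mulr_ge0 // ltW // (alpha_gt0 params).
Qed.

Lemma eta_g_gt0 k : 0 < eta_g mu_g alpha beta k.
Proof.
have a0 := alpha_gt0 params k.
rewrite ltr_pwDl ?mulr_ge0 ?(ltW a0) //.
by rewrite mulr_gt0 ?(beta_gt0 params) // addr_gt0.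
Qed.

Definition v_gradient k : 'cV[R]_m :=
  grad f1 (us it k) + A^T *m lbar it k.+1
  + (eta_f mu_f alpha gamma k / alpha k)
    *: (vs it k.+1 - v_tilde mu_f alpha gamma it k).

Definition y_gradient k : 'cV[R]_n :=
  B^T *m lbar it k.+1
  + (eta_g mu_g alpha beta k / alpha k ^+ 2)
    *: (ys it k.+1 - y_tilde mu_g alpha beta it k).

Lemma H_v_vi k : is_argmin X
    (fun z => f2 z
       + (dot (grad f1 (us it k) + A^T *m lbar it k.+1) z
          + eta_f mu_f alpha gamma k / (2 * alpha k)
            * enorm (z - v_tilde mu_f alpha gamma it k) ^+ 2)%:E)%E
    (vs it k.+1)
  <-> proximal_vi X f2 (v_gradient k) (vs it k.+1).
Proof.
have a0 := alpha_gt0 params k.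
rewrite argmin_linear_quad //.
  rewrite /v_gradient; suff -> : 2 * (eta_f mu_f alpha gamma k / (2 * alpha k))
    = eta_f mu_f alpha gamma k / alpha k by [].
  by field; rewrite gt_eqF.
by rewrite divr_ge0 ?mulr_ge0 ?(ltW a0) // ltW // eta_f_gt0.
Qed.

(** At the minimizer the gradient of the penalty is A^T (lbar - lambda_k), which turns the explicit
    multiplier lambda_k into the implicit [lbar]. *)
Lemma alg_v_vi k :
  lbar it k.+1 = lam it k + (alpha k / theta k)
                   *: (A *m vs it k.+1 + B *m ws it k - b) ->
  is_argmin X
      (fun z => f2 z
         + (dot (grad f1 (us it k) + A^T *m lam it k) z
            + alpha k / (2 * theta k) * enorm (A *m z + B *m ws it k - b) ^+ 2
            + eta_f mu_f alpha gamma k / (2 * alpha k)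
              * enorm (z - v_tilde mu_f alpha gamma it k) ^+ 2)%:E)%E
      (vs it k.+1)
  <-> proximal_vi X f2 (v_gradient k) (vs it k.+1).
Proof.
have a0 := alpha_gt0 params k; have t0 := theta_gt0 params k.
move=> lbE; rewrite argmin_penalized_quad //.
- rewrite /v_gradient lbE (mulmxDr _ (lam it k)) -scalemxAr addrA.
  have -> : 2 * (eta_f mu_f alpha gamma k / (2 * alpha k))
    = eta_f mu_f alpha gamma k / alpha k by field; rewrite gt_eqF.
  suff -> : 2 * (alpha k / (2 * theta k)) = alpha k / theta k by [].
  by field; rewrite gt_eqF.
- by rewrite divr_ge0 ?mulr_ge0 ?(ltW t0) // ltW.
- by rewrite divr_ge0 ?mulr_ge0 ?(ltW a0) // ltW // eta_f_gt0.
Qed.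

Lemma H_y_vi k : is_argmin Y
    (fun z => g z
       + (dot (B *m z) (lbar it k.+1)
          + eta_g mu_g alpha beta k / (2 * alpha k ^+ 2)
            * enorm (z - y_tilde mu_g alpha beta it k) ^+ 2)%:E)%E
    (ys it k.+1)
  <-> proximal_vi Y g (y_gradient k) (ys it k.+1).
Proof.
have a0 := alpha_gt0 params k.
under eq_fun do rewrite dot_mulmx dotC.
rewrite argmin_linear_quad //.
  rewrite /y_gradient; suff -> : 2 * (eta_g mu_g alpha beta k / (2 * alpha k ^+ 2))
    = eta_g mu_g alpha beta k / alpha k ^+ 2 by [].
  by field; rewrite gt_eqF.
by rewrite divr_ge0 ?mulr_ge0 ?sqr_ge0 // ltW // eta_g_gt0.
Qed.

Lemma alg_y_vi k :
  is_prox Y (tau mu_g alpha beta k) g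
    (y_tilde mu_g alpha beta it k
     - tau mu_g alpha beta k *: (B^T *m lbar it k.+1)) (ys it k.+1)
  <-> proximal_vi Y g (y_gradient k) (ys it k.+1).
Proof.
have a0 := alpha_gt0 params k.
rewrite prox_vi // /tau ?invf_div //.
by rewrite divr_gt0 ?exprn_gt0 // eta_g_gt0.
Qed.

Lemma scheme_H_algorithm :
  scheme_H X Y A B b f1 f2 g mu_f mu_g alpha theta gamma beta it
     /\ lbar_choice A B b alpha theta it
  <-> algorithm X Y A B b f1 f2 g mu_f mu_g alpha theta gamma beta it.
Proof.
split=> [[[? ? Hv ? Hy ? ?] lbE]|[? ? Hv ? lbE Hy ? ?]].
  split=> // k; first by apply/alg_v_vi => //; apply/H_v_vi.
  by apply/alg_y_vi/H_y_vi.
split=> //; split=> // k; first by apply/H_v_vi/alg_v_vi.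
by apply/H_y_vi/alg_y_vi.
Qed.

End Equivalence.

(** * Real-valued forms of the convexity assumptions *)

Section ExtendedValuedConvexity.
Set Implicit Arguments.
Unset Strict Implicit.
Context {R : realType} {m : nat}.
Implicit Types (X : set 'cV[R]_m) (h : 'cV[R]_m -> \bar R).

Lemma fin_num_lt (e : \bar R) : (e != -oo)%E -> (e < +oo)%E -> e \is a fin_num.
Proof. by case: e. Qed.

Lemma S0_lower mu X h (x z p : 'cV[R]_m) : S0 mu X h -> X x -> X z ->
  subgradient_on X h x p -> h z \is a fin_num ->
  fine (h x) + dot p (z - x) + mu / 2 * enorm (z - x) ^+ 2 <= fine (h z).
Proof.
move=> [_ hS] Xx Xz hp hz; have := hS _ _ _ Xz Xx hp.
have [hx _] := hp; rewrite -{1}(fineK hx) -{1}(fineK hz) -!EFinB lee_fin; lra.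
Qed.

Lemma proximal_vi_subgradient X h q x : (forall z, h z != -oo%E) ->
  proximal_vi X h q x -> subgradient_on X h x (- q).
Proof.
move=> hNy [Xx hx hq]; apply: subgradient_on_dot => //; first exact: fin_num_lt.
by move=> z Xz; rewrite opprK; exact: hq.
Qed.

Lemma S11_fin mu L X h x : S11 mu L X h -> X x -> h x \is a fin_num.
Proof. by move=> [_ hd _] /hd [/nbhs_singleton]. Qed.

(** By convexity the gradient is itself a subgradient on X, so the condition in [S0] applies to
    it. *)
Lemma S11_lower mu L X h (x z : 'cV[R]_m) : S11 mu L X h -> X x -> X z ->
  fine (h x) + dot (grad h x) (z - x) + mu / 2 * enorm (z - x) ^+ 2
    <= fine (h z).
Proof.
move=> hS Xx Xz; have hz := S11_fin hS Xz; have [S0h hd _] := hS.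
apply: (S0_lower S0h Xx Xz) => //; split=> [|y Xy]; first exact: S11_fin hS Xx.
have hy := S11_fin hS Xy; have [[[hNy _] _ ch] _] := S0h.
rewrite -(fineK (S11_fin hS Xx)) -(fineK hy) -EFinD lee_fin.
by apply: convex_grad_le => //; exact: hd.
Qed.

Lemma S11_upper mu L X h (x z : 'cV[R]_m) : S11 mu L X h -> X x -> X z ->
  fine (h z)
    <= fine (h x) + dot (grad h x) (z - x) + L / 2 * enorm (z - x) ^+ 2.
Proof.
move=> hS Xx Xz; have [_ _ hL] := hS; have := hL z x Xz Xx.
rewrite -{1}(fineK (S11_fin hS Xx)) -{1}(fineK (S11_fin hS Xz)).
by rewrite -!EFinB lee_fin; lra.
Qed.

Lemma weighted_averageE (a : R) (x z : 'cV[R]_m) : 0 < a ->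
  (1 + a)^-1 *: (x + a *: z) = (1 + a)^-1 *: x + (1 - (1 + a)^-1) *: z.
Proof.
move=> a0; have a1 : 1 + a != 0 by rewrite gt_eqF // addr_gt0.
by rewrite scalerDr scalerA; congr (_ + _ *: _); field.
Qed.

Lemma weight_in01 (a : R) : 0 < a -> 0 <= (1 + a)^-1 <= 1.
Proof.
by move=> a0; rewrite invr_ge0 invf_le1 ?addr_gt0 // lerDl addr_ge0 ltW.
Qed.

Lemma convex_set_average X (a : R) (x z : 'cV[R]_m) : convex_set X -> 0 < a ->
  X x -> X z -> X ((1 + a)^-1 *: (x + a *: z)).
Proof.
move=> cX a0 Xx Xz; rewrite weighted_averageE //.
by apply: convex_set_comb => //; exact: weight_in01.
Qed.

Lemma convex_efun_average h (a : R) (x z : 'cV[R]_m) :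
  convex_efun h -> (forall z, h z != -oo%E) -> 0 < a ->
  h x \is a fin_num -> h z \is a fin_num ->
  let y := (1 + a)^-1 *: (x + a *: z) in
  h y \is a fin_num /\ (1 + a) * fine (h y) <= fine (h x) + a * fine (h z).
Proof.
move=> ch hNy a0 hx hz y.
have := ch x z _ (weight_in01 a0); rewrite -weighted_averageE // -/y.
rewrite -(fineK hx) -(fineK hz) -!EFinM -EFinD.
case: (h y) (hNy y) => [e| |] //= _; rewrite lee_fin => le_e; split=> //.
have a1 : 0 < 1 + a by rewrite addr_gt0.
apply: le_trans (ler_wpM2l (ltW a1) le_e) _.
rewrite le_eqVlt; apply/orP; left; apply/eqP; field; rewrite gt_eqF //.
Qed.

End ExtendedValuedConvexity.

(** * Decay of the Lyapunov function and error estimates *)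

Section Convergence.
Set Implicit Arguments.
Unset Strict Implicit.
Context {R : realType} {m n r : nat}.
Variables (X : set 'cV[R]_m) (Y : set 'cV[R]_n).
Variables (A : 'M[R]_(r, m)) (B : 'M[R]_(r, n)) (b : 'cV[R]_r).
Variables (f f1 f2 : 'cV[R]_m -> \bar R) (g : 'cV[R]_n -> \bar R).
Variables (Lf mu_f mu_g : R) (alpha theta gamma beta : nat -> R).
Variable it : iterates R m n r.
Variables (xst : 'cV[R]_m) (yst : 'cV[R]_n) (lst : 'cV[R]_r).
Hypotheses (cX : convex_set X) (cY : convex_set Y).
Hypothesis fE : forall x, f x = (f1 x + f2 x)%E.
Hypothesis mu_Lf : 0 <= mu_f <= Lf.
Hypotheses (f1S : S11 mu_f Lf X f1) (f2S : S0 0 X f2).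
Hypotheses (mu_g_ge0 : 0 <= mu_g) (gS : S0 mu_g Y g).
Hypothesis params : parameters_spec mu_f mu_g alpha theta gamma beta.
Hypothesis alg :
  algorithm X Y A B b f1 f2 g mu_f mu_g alpha theta gamma beta it.
Hypothesis saddle : saddle_point X Y A B b f g xst yst lst.
Hypothesis step :
  forall k, (Lf * beta k * theta k + gamma k * opnorm B ^+ 2) * alpha k ^+ 2
            = gamma k * beta k * theta k.

Local Notation x := (xs it).
Local Notation u := (us it).
Local Notation v := (vs it).
Local Notation y := (ys it).
Local Notation w := (ws it).
Local Notation la := (lam it).
Local Notation lb := (lbar it).

Let residual k := A *m x k + B *m y k - b.
Let a_gt0 := alpha_gt0 params.
Let t_gt0 := theta_gt0 params.
Let mu_f_ge0 : 0 <= mu_f. Proof. by case/andP: mu_Lf. Qed.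
Let Lf_ge0 : 0 <= Lf.
Proof. by case/andP: mu_Lf => m0; exact: le_trans. Qed.

Let f2Ny z : f2 z != -oo%E.
Proof. by case: f2S => -[[+ _] _ _] _; apply. Qed.
Let gNy z : g z != -oo%E.
Proof. by case: gS => -[[+ _] _ _] _; apply. Qed.
Let f1Ny z : f1 z != -oo%E.
Proof. by case: f1S => -[[[+ _] _ _] _] _ _; apply. Qed.
Let f2_convex : convex_efun f2. Proof. by case: f2S => -[]. Qed.
Let g_convex : convex_efun g. Proof. by case: gS => -[]. Qed.

Let v_vi k : proximal_vi X f2
  (v_gradient A f1 mu_f alpha gamma it k) (v k.+1).
Proof.
case: alg => _ _ Hv _ lbE _ _ _; apply/alg_v_vi; last exact: Hv.
all: eauto.
Qed.

Let y_vi k : proximal_vi Y g (y_gradient B mu_g alpha beta it k) (y k.+1).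
Proof. by case: alg => _ _ _ _ _ Hy _ _; apply/alg_y_vi; eauto. Qed.

Lemma Xv k : X (v k).
Proof. by case: k => [|k]; [case: alg => -[]|case: (v_vi k)]. Qed.

Lemma Xx k : X (x k).
Proof.
elim: k => [|k IH]; first by case: alg => -[].
by rewrite (alg_x alg); apply: convex_set_average => //; exact: Xv.
Qed.

Lemma Xu k : X (u k).
Proof.
by rewrite (alg_u alg); apply: convex_set_average => //; [exact: Xx|exact: Xv].
Qed.

Lemma YyS k : Y (y k.+1). Proof. by case: (y_vi k). Qed.

Let f1_fin z : X z -> f1 z \is a fin_num := S11_fin f1S.

Let f2v_fin k : f2 (v k.+1) \is a fin_num.
Proof. by case: (v_vi k) => _ + _; exact: fin_num_lt. Qed.

Let gy_fin k : g (y k.+1) \is a fin_num.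
Proof. by case: (y_vi k) => _ + _; exact: fin_num_lt. Qed.

Let F z t : R := fine (f1 z) + fine (f2 z) + fine (g t).

Lemma objective_fin z t : X z -> f2 z \is a fin_num -> g t \is a fin_num ->
  objective f g z t = (F z t)%:E.
Proof.
move=> Xz f2z gt; rewrite /objective fE -(fineK (f1_fin Xz)).
by rewrite -(fineK f2z) -(fineK gt) -!EFinD.
Qed.

Lemma lagrangian_fin z t l : X z -> Y t -> f2 z \is a fin_num ->
  g t \is a fin_num ->
  lagrangian X Y A B b f g z t l = (F z t + dot l (A *m z + B *m t - b))%:E.
Proof.
move=> Xz Yt f2z gt; rewrite /lagrangian objective_fin // /indic_fun.
by rewrite mem_set // adde0 -EFinD.
Qed.

(** No summand is -oo, and f1 is finite on X, so any failure makes the sum +oo. *)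
Lemma lagrangian_pinfty z t l :
  X z -> ~ [/\ Y t, f2 z \is a fin_num & g t \is a fin_num] ->
  lagrangian X Y A B b f g z t l = +oo%E.
Proof.
move=> Xz nfin; rewrite /lagrangian.
suff -> : (objective f g z t + indic_fun (X `*` Y) (z, t) = +oo)%E by rewrite addye.
have oNy : objective f g z t != -oo%E.
  rewrite /objective fE -(fineK (f1_fin Xz)).
  by case: (f2 z) (f2Ny z) (g t) (gNy t) => [?| |] // _ [?| |] // _.
rewrite /indic_fun; case: ifPn => [/set_mem[_ Yt]|_]; last by rewrite addey.
rewrite adde0 /objective fE -(fineK (f1_fin Xz)).
case f2E : (f2 z) (f2Ny z) => [c| |] // _; last first.
  by rewrite addey // addye.
case gE : (g t) (gNy t) => [d| |] // _.
by case: nfin; split; rewrite ?f2E ?gE.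
Qed.

Let saddle_mem : X xst /\ Y yst. Proof. by case: saddle. Qed.

(* [saddle_point] alone also holds when the Lagrangian is +oo everywhere, but
   it is finite at the first iterates (v_1, y_1). *)
Let saddle_fin : f2 xst \is a fin_num /\ g yst \is a fin_num.
Proof.
have [Xs Ys /(_ (v 1%N) (y 1%N) 0)[_]] := saddle.
rewrite [X in (_ <= X)%E]lagrangian_fin ?f2v_fin ?gy_fin //; last 2 first.
- exact: Xv.
- exact: YyS.
have [[]|nfin] := pselect [/\ Y yst, f2 xst \is a fin_num & g yst \is a fin_num].
  by [].
by rewrite lagrangian_pinfty.
Qed.

(** Maximality in the multiplier, tested at [lst] plus the residual e, gives |e|^2 <= 0. *)
Lemma saddle_feasible : A *m xst + B *m yst = b.
Proof.
have [f2s gs] := saddle_fin; have [Xs Ys] := saddle_mem.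
set e := A *m xst + B *m yst - b.
have [_ _ /(_ xst yst (lst + e))[+ _]] := saddle.
rewrite !lagrangian_fin // lee_fin -/e dotDl => le_e.
have /enorm_eq0 : enorm e = 0.
  by apply/eqP; rewrite -sqrf_eq0 sqr_enorm eq_le dot_ge0 andbT; lra.
by move/eqP; rewrite subr_eq0 => /eqP.
Qed.

Lemma lagrangian_saddle l :
  lagrangian X Y A B b f g xst yst l = (F xst yst)%:E.
Proof.
have [f2s gs] := saddle_fin; have [Xs Ys] := saddle_mem.
by rewrite lagrangian_fin // saddle_feasible subrr dot0r addr0.
Qed.

(** As x_k lies in X, this singles out the indices where the Lagrangian at the iterate is finite. *)
Let finite k := [/\ Y (y k), f2 (x k) \is a fin_num & g (y k) \is a fin_num].

Lemma finiteS k : finite k -> finite k.+1.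
Proof.
move=> [_ f2x _]; split; [exact: YyS| |exact: gy_fin].
rewrite (alg_x alg).
by case: (convex_efun_average f2_convex f2Ny (a_gt0 k) f2x (f2v_fin k)).
Qed.

Let gap k := F (x k) (y k) + dot lst (residual k) - F xst yst.

Lemma gap_ge0 k : finite k -> 0 <= gap k.
Proof.
move=> [Yy f2x gy]; have [_ _ /(_ (x k) (y k) lst)[_]] := saddle.
rewrite lagrangian_saddle lagrangian_fin //; last exact: Xx.
rewrite lee_fin /gap /residual; lra.
Qed.

Let energy k := gap k + (gamma k / 2 * enorm (v k - xst) ^+ 2
  + beta k / 2 * enorm (w k - yst) ^+ 2
  + theta k / 2 * enorm (la k - lst) ^+ 2).

Lemma lyapunov_fin k : finite k ->
  lyapunov X Y A B b f g theta gamma beta it xst yst lst k = (energy k)%:E.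
Proof.
move=> [Yy f2x gy]; rewrite /lyapunov lagrangian_saddle.
by rewrite lagrangian_fin //; exact: Xx.
Qed.

Lemma lyapunov_pinfty k : ~ finite k ->
  lyapunov X Y A B b f g theta gamma beta it xst yst lst k = +oo%E.
Proof.
move=> nfin; rewrite /lyapunov lagrangian_saddle lagrangian_pinfty //.
exact: Xx.
Qed.

(** alpha v_{k+1} = (1 + alpha) x_{k+1} - x_k, and the same holds for w and y; then (1 + alpha_k) /
    theta_k = 1 / theta_{k+1}. *)
Lemma dual_residual k : la k.+1 = la k + ((theta k.+1)^-1 *: residual k.+1
                                        - (theta k)^-1 *: residual k).
Proof.
have a0 := a_gt0 k; have a1 : 0 < 1 + alpha k by rewrite addr_gt0.
have vE : alpha k *: v k.+1 = (1 + alpha k) *: x k.+1 - x k.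
  by rewrite (alg_x alg) scalerA mulfV ?gt_eqF // scale1r addrC addKr.
have wE : alpha k *: w k.+1 = (1 + alpha k) *: y k.+1 - y k.
  rewrite (alg_w alg) scalerDr scalerA mulfV ?gt_eqF //.
  by apply/colP => i; rewrite !mxE; ring.
rewrite (alg_lam alg); congr (_ + _).
have -> : (theta k.+1)^-1 = (1 + alpha k) / theta k.
  by rewrite -(theta_rec params k); field; rewrite !gt_eqF // t_gt0.
rewrite mulrC [(1 + _) / _]mulrC -!scalerA -scalerBr; congr (_ *: _).
rewrite scalerBr scalerDr !scalemxAr vE wE !mulmxBr /residual.
rewrite -!scalemxAr; apply/colP => i; rewrite !mxE; ring.
Qed.

Lemma residualE k :
  residual k = theta k *: (la k - la 0%N + residual 0%N).
Proof.
have t_neq0 i : theta i != 0 by rewrite gt_eqF // t_gt0.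
suff laE : la k = la 0%N + (theta k)^-1 *: residual k - residual 0%N.
  rewrite laE [X in _ *: X](_ : _ = (theta k)^-1 *: residual k); last first.
    by apply/colP => i; rewrite !mxE; ring.
  by rewrite scalerA mulfV // scale1r.
elim: k => [|k IH]; first by rewrite (theta0 params) invr1 scale1r addrK.
rewrite dual_residual {1}IH; apply/colP => i; rewrite !mxE; ring.
Qed.

(** The sum of the three one-step inequalities: the terms in [lbar] cancel, and so does beta / 2
    |w_{k+1} - w_k|^2. *)
Lemma energy_decay k : finite k -> (1 + alpha k) * energy k.+1 <= energy k.
Proof.
move=> fin_k; have [Yy1 f2x1 gy1] := finiteS fin_k; have [Yy f2x gy] := fin_k.
have [f2s gs] := saddle_fin; have [Xs Ys] := saddle_mem.
have a0 := a_gt0 k; have t0 := t_gt0 k.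
have g0 := gamma_gt0 params k mu_f_ge0; have b0 := beta_gt0 params k mu_g_ge0.
have stepk := step k.
(* The left side of the step size rule has two nonnegative summands; keeping one and cancelling a
   positive factor gives [step1], keeping the other [step2]. *)
have step1 : Lf * alpha k ^+ 2 <= gamma k.
  rewrite -(ler_pM2l (mulr_gt0 b0 t0)).
  have := mulr_ge0 (ltW g0) (mulr_ge0 (sqr_ge0 (opnorm B)) (sqr_ge0 (alpha k))).
  lra.
have step2 : opnorm B ^+ 2 * alpha k ^+ 2 <= beta k * theta k.
  rewrite -(ler_pM2l g0).
  have := mulr_ge0 Lf_ge0 (mulr_ge0 (ltW (mulr_gt0 b0 t0)) (sqr_ge0 (alpha k))).
  lra.
pose cx := A^T *m lb k.+1; pose cy := B^T *m lb k.+1.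
pose px := - v_gradient A f1 mu_f alpha gamma it k.
pose py := - y_gradient B mu_g alpha beta it k.
have px_sub : subgradient_on X f2 (v k.+1) px by exact: proximal_vi_subgradient.
have py_sub : subgradient_on Y g (y k.+1) py by exact: proximal_vi_subgradient.
have etaf0 := eta_f_gt0 mu_f_ge0 params k.
have etag0 := eta_g_gt0 mu_g_ge0 params k.
(* [v_tilde] is the mean that makes eta_f (v_{k+1} - v_tilde) split into these two differences;
   [y_tilde] plays the same part in [pyE]. *)
have pxE : alpha k *: px = - (alpha k *: (grad f1 (u k) + cx)
    + gamma k *: (v k.+1 - v k) + (mu_f * alpha k) *: (v k.+1 - u k)).
  rewrite scalerN /v_gradient scalerDr scalerA; congr (- _).
  rewrite -addrA; congr (_ + _); rewrite mulrC divfK ?gt_eqF //.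
  rewrite scalerBr /v_tilde scalerA mulfV ?gt_eqF // scale1r.
  by rewrite {1}/eta_f; apply/colP => i; rewrite !mxE; ring.
have wE := alg_w alg k.
have pyE : alpha k *: py = - (alpha k *: cy + beta k *: (w k.+1 - w k)
    + (mu_g * alpha k) *: (w k.+1 - y k.+1)).
  rewrite scalerN /y_gradient scalerDr scalerA; congr (- _).
  rewrite -addrA; congr (_ + _); rewrite /y_tilde wE.
  apply/colP => i; rewrite !mxE.
  move: etag0; rewrite /eta_g => etag0.
  by field; rewrite !gt_eqF.
have [_ f2x1_le] := convex_efun_average f2_convex f2Ny a0 f2x (f2v_fin k).
rewrite -(alg_x alg) in f2x1_le.
have f2v_le : fine (f2 (v k.+1)) <= fine (f2 xst) + dot px (v k.+1 - xst).
  have := S0_lower f2S (Xv k.+1) Xs px_sub f2s.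
  by rewrite mul0r mul0r addr0 -(opprB xst) dotNr; lra.
have Sx := x_step a0 mu_f_ge0 Lf_ge0 step1 (alg_u alg k) (alg_x alg k) pxE
  (S11_upper f1S (Xu k) (Xx k.+1)) (S11_lower f1S (Xu k) (Xx k))
  (S11_lower f1S (Xu k) Xs) f2x1_le f2v_le.
have Sy := y_step a0 mu_g_ge0 wE pyE (S0_lower gS (YyS k) Yy py_sub gy)
  (S0_lower gS (YyS k) Ys py_sub gs).
have Sl := multiplier_step lst t0 step2 saddle_feasible (alg_lam alg k)
  (alg_lbar alg k).
(* Two expressions of lambda_{k+1} - lambda_k are compared: the linear part of the gap changes by
   exactly the term in [Sl]. *)
have qE : (1 + alpha k) * dot lst (residual k.+1) - dot lst (residual k)
    = alpha k * dot lst (A *m v k.+1 + B *m w k.+1 - b).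
  have := alg_lam alg k; rewrite dual_residual => /addrI lamE.
  have : dot lst ((theta k.+1)^-1 *: residual k.+1 - (theta k)^-1 *: residual k)
      = dot lst ((alpha k / theta k) *: (A *m v k.+1 + B *m w k.+1 - b)).
    by rewrite lamE.
  rewrite dotDr dotNr !dotZr => dotE.
  have t1 := t_gt0 k.+1; have a1 : 0 < 1 + alpha k by rewrite addr_gt0.
  have -> : (1 + alpha k) * dot lst (residual k.+1) - dot lst (residual k)
      = theta k * ((theta k.+1)^-1 * dot lst (residual k.+1)
                   - (theta k)^-1 * dot lst (residual k)).
    by rewrite -(theta_rec params k); field; rewrite !gt_eqF.
  by rewrite dotE mulrA mulrCA mulfV ?gt_eqF // mulr1.
have gE := gamma_rec params k; have bE := beta_rec params k.
have tE := theta_rec params k.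
(* The recurrences turn the coefficients of the new distances into 1 + alpha times the new
   parameters, after which the claim is linear. *)
rewrite -gE -bE in Sx Sy *.
rewrite /energy /gap /F; rewrite -tE in Sl *.
lra.
Qed.

Lemma energy_le k : finite 0%N -> finite k /\ energy k <= theta k * energy 0%N.
Proof.
move=> fin0; elim: k => [|k [fin_k IH]]; first by rewrite (theta0 params) mul1r.
split; first exact: finiteS.
have a1 : 0 < 1 + alpha k by rewrite addr_gt0.
rewrite -(ler_pM2l a1); apply: le_trans (energy_decay fin_k) _.
by rewrite mulrA [_ * theta _]mulrC (theta_rec params).
Qed.

Let R0r := Num.sqrt (2 * energy 0%N) + (enorm (la 0%N - lst) + enorm (residual 0%N)).

(** theta_k / 2 |lambda_k - lambda^*|^2 <= E_k <= theta_k E_0, and theta_k cancels: the bound is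
    uniform in k. *)
Lemma lam_dist_le k : finite 0%N -> enorm (la k - lst) <= Num.sqrt (2 * energy 0%N).
Proof.
move=> fin0; have [fin_k E_le] := energy_le k fin0.
have t0 := t_gt0 k.
have le_E : theta k / 2 * enorm (la k - lst) ^+ 2 <= energy k.
  rewrite /energy; have := gap_ge0 fin_k.
  have gk : 0 <= gamma k / 2 * enorm (v k - xst) ^+ 2.
    by rewrite !mulr_ge0 ?enorm_ge0 // ltW // (gamma_gt0 params).
  have bk : 0 <= beta k / 2 * enorm (w k - yst) ^+ 2.
    by rewrite !mulr_ge0 ?enorm_ge0 // ltW // (beta_gt0 params).
  lra.
rewrite -[leLHS]ger0_norm ?enorm_ge0 // -sqrtr_sqr ler_wsqrtr //.
rewrite -(ler_pM2l t0); lra.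
Qed.

Lemma residual_le k : finite 0%N -> enorm (residual k) <= theta k * R0r.
Proof.
move=> fin0; rewrite residualE enormZ gtr0_norm ?t_gt0 //.
apply: ler_wpM2l; first exact: ltW (t_gt0 k).
have -> : la k - la 0%N + residual 0%N
    = (la k - lst) - (la 0%N - lst) + residual 0%N.
  by apply/colP => i; rewrite !mxE; ring.
apply: le_trans (enormD _ _) _; rewrite /R0r addrA lerD2r.
apply: le_trans (enormB _ _) _; rewrite lerD2r.
exact: lam_dist_le.
Qed.

Lemma objective_le k : finite 0%N ->
  `|F (x k) (y k) - F xst yst| <= theta k * (energy 0%N + enorm lst * R0r).
Proof.
move=> fin0; have [fin_k E_le] := energy_le k fin0.
have t0 := t_gt0 k.
have gap_le : gap k <= energy k.
  rewrite /energy lerDl !addr_ge0 // !mulr_ge0 ?enorm_ge0 // ltW //.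
  - exact: (gamma_gt0 params).
  - exact: (beta_gt0 params).
have -> : F (x k) (y k) - F xst yst = gap k - dot lst (residual k).
  by rewrite /gap; ring.
apply: le_trans (ler_normB _ _) _; rewrite (ger0_norm (gap_ge0 fin_k)).
rewrite mulrDr lerD ?(le_trans gap_le) //.
apply: le_trans (Cauchy_Schwarz _ _) _; rewrite mulrCA.
by rewrite ler_wpM2l ?enorm_ge0 // residual_le.
Qed.

Lemma convergence :
  let E0 := lyapunov X Y A B b f g theta gamma beta it xst yst lst 0%N in
  let R0 := R0 X Y A B b f g theta gamma beta it xst yst lst in
  (forall k, ((enorm (A *m xs it k + B *m ys it k - b))%:E
              <= (theta k)%:E * R0)%E) /\
  (forall k, (`|objective f g (xs it k) (ys it k) - objective f g xst yst|
              <= (theta k)%:E * (E0 + (enorm lst)%:E * R0))%E).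
Proof.
move=> E0 R0; have [fin0|nfin0] := pselect (finite 0%N).
  have E0E : E0 = (energy 0%N)%:E by exact: lyapunov_fin.
  have R0E : R0 = R0r%:E.
    by rewrite /R0 /Defs.R0 -/E0 E0E -EFinM.
  rewrite E0E R0E -EFinM -EFinD; split=> k; rewrite -EFinM.
    by rewrite lee_fin; exact: residual_le.
  have [[Yy f2x gy] _] := energy_le k fin0.
  have [f2s gs] := saddle_fin; have [Xs _] := saddle_mem.
  rewrite !objective_fin //; last exact: Xx.
  rewrite -EFinB abse_EFin lee_fin.
  exact: objective_le.
(* Otherwise E_0 and R_0 are +oo, and as theta_k > 0 both bounds are trivial. *)
have E0E : E0 = +oo%E by exact: lyapunov_pinfty.
have R0E : R0 = +oo%E.
  by rewrite /R0 /Defs.R0 -/E0 E0E gt0_muley ?lte_fin // addye.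
rewrite E0E R0E; split=> k.
  by rewrite gt0_muley ?lte_fin ?t_gt0 // leey.
(* The product of |lambda^*| and +oo is 0 or +oo, never -oo, so the sum is +oo. *)
rewrite addye; last first.
  by rewrite gt_eqF // (@lt_le_trans _ _ 0%E) ?mule_ge0 ?lee_fin ?enorm_ge0 ?leey.
by rewrite gt0_muley ?lte_fin ?t_gt0 // leey.
Qed.

End Convergence.

Theorem theorem4p1 (R : realType) (Lf : R) :
  exists2 C : R, 0 < C &
  forall (m n r : nat) (X : set 'cV[R]_m) (Y : set 'cV[R]_n)
    (A : 'M[R]_(r, m)) (B : 'M[R]_(r, n)) (b : 'cV[R]_r)
    (f f1 f2 : 'cV[R]_m -> \bar R) (g : 'cV[R]_n -> \bar R)
    (mu_f mu_g : R) (alpha theta gamma beta : nat -> R)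
    (it : iterates R m n r),
  closed X -> convex_set X -> closed Y -> convex_set Y ->
  proper_closed_convex f ->
  (forall x, f x = (f1 x + f2 x)%E) ->
  0 <= mu_f <= Lf -> S11 mu_f Lf X f1 -> S0 0 X f2 ->
  0 <= mu_g -> S0 mu_g Y g ->
  parameters_spec mu_f mu_g alpha theta gamma beta ->
  (scheme_H X Y A B b f1 f2 g mu_f mu_g alpha theta gamma beta it
     /\ lbar_choice A B b alpha theta it
   <-> algorithm X Y A B b f1 f2 g mu_f mu_g alpha theta gamma beta it) /\
  (forall (xst : 'cV[R]_m) (yst : 'cV[R]_n) (lst : 'cV[R]_r),
   algorithm X Y A B b f1 f2 g mu_f mu_g alpha theta gamma beta it ->
   saddle_point X Y A B b f g xst yst lst ->
   (0 < mu_f -> gamma 0%N = mu_f) ->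
   (0 < mu_g -> beta 0%N = mu_g) ->
   (forall k, (Lf * beta k * theta k + gamma k * opnorm B ^+ 2) * alpha k ^+ 2
              = gamma k * beta k * theta k) ->
   let F := objective f g in
   let E0 := lyapunov X Y A B b f g theta gamma beta it xst yst lst 0%N in
   let R0 := R0 X Y A B b f g theta gamma beta it xst yst lst in
   [/\ forall k, (0 < k)%N -> X (xs it k) /\ Y (ys it k),
       forall k, ((enorm (A *m xs it k + B *m ys it k - b))%:E
                  <= (theta k)%:E * R0)%E,
       forall k, (`|F (xs it k) (ys it k) - F xst yst|
                  <= (theta k)%:E * (E0 + (enorm lst)%:E * R0))%E
     & gamma 0%N * beta 0%N <= Lf * beta 0%N + gamma 0%N * opnorm B ^+ 2 ->
       forall k, (0 < k)%N ->
         ((theta k)%:E <=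
          C%:E * (mine (opnorm B / (Num.sqrt (beta 0%N) * k%:R))%:E
                       (if mu_g == 0%R then +oo
                        else (opnorm B ^+ 2 / (mu_g * k%:R ^+ 2))%:E)
                  + (Num.min (Lf / (gamma 0%N * k%:R ^+ 2))
                             (expR (- (k%:R / 4) * Num.sqrt (mu_f / Lf))))%:E))%E]).
Proof.
(* The factor common to both alternatives of [theta_rate]. *)
exists 64 => // m n r X Y A B b f f1 f2 g mu_f mu_g alpha theta gamma beta it.
move=> _ cX _ cY _ fE mu_Lf f1S f2S mu_g0 gS params.
have mu_f0 : 0 <= mu_f by case/andP: mu_Lf.
split.
  have [[[f2Ny _] _ cf2] _] := f2S; have [[[gNy _] _ cg] _] := gS.
  exact: scheme_H_algorithm.
move=> xst yst lst alg saddle g0E b0E step F E0 R0.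
have [feas obj] := convergence cX cY fE mu_Lf f1S f2S mu_g0 gS params alg saddle step.
split=> //.
  move=> [//|k] _; split.
    exact: (Xx cX mu_Lf f2S params alg).
  exact: (YyS cY mu_g0 gS params alg).
move=> step0 k k0.
have N0 := opnorm_ge0 B.
have kR : 0 < k%:R :> R by rewrite ltr0n.
have g0 := gamma0_gt0 params; have b0 := beta0_gt0 params.
have L0 : 0 <= Lf by case/andP: mu_Lf; exact: le_trans.
set M := Num.min _ (expR _).
have M0 : 0 <= M.
  by rewrite le_min expR_ge0 divr_ge0 ?mulr_ge0 ?sqr_ge0 // ltW.
set c1 := opnorm B / _; set c2 := opnorm B ^+ 2 / _.
have c10 : 0 <= c1 by rewrite divr_ge0 ?mulr_ge0 ?sqrtr_ge0 // ltW.
have c20 : 0 <= c2 by rewrite divr_ge0 ?mulr_ge0 ?sqr_ge0 // ltW.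
(* In each alternative the other minimum is nonnegative and may be added. If [mu_g] = 0, the first
   minimum reduces to its first entry. *)
have [th|[th1 th2]] := theta_rate params mu_Lf g0E N0 mu_g0 b0E step step0 k0;
  case: eqVneq => [_|mu_g_neq0].
- rewrite min_l ?leey // -EFinD -EFinM lee_fin; apply: le_trans th _.
  by rewrite -/M; lra.
- rewrite -EFin_min -EFinD -EFinM lee_fin; apply: le_trans th _.
  by rewrite -/M ler_wpM2l // lerDr le_min c10.
- rewrite min_l ?leey // -EFinD -EFinM lee_fin; apply: le_trans th1 _.
  by rewrite -/c1; lra.
- rewrite -EFin_min -EFinD -EFinM lee_fin.
  have {}th2 := th2 (_ : 0 < mu_g); rewrite lt_neqAle eq_sym mu_g_neq0 in th2.
  rewrite mulrDr; apply: (le_trans _ (_ : 64 * Num.min c1 c2 <= _)); last by lra.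
  by rewrite minr_pMr // le_min th1 th2.
Qed.
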